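(* Let $(R,\mathfrak{m},k)$ be a commutative local ring with maximal ideal $\mathfrak{m}$ and residue field $k=R/\mathfrak{m}$ such that $\mathfrak{m}^2=0$, and suppose that $\dim_k\mathfrak{m}=\kappa$ is infinite. Then $R$ is a $\kappa$-coherent ring. Let $M=R^{\aleph}$ be the direct product of $\aleph$ copies of $R$, where $\aleph$ is an arbitrary infinite cardinal. Then $\operatorname{fd}_R(M)=\infty$. Consequently, $R$ is not a weakly coherent ring, and so not a generalized coherent ring.
   Context: $\operatorname{fd}_R$ denotes flat dimension. For an infinite cardinal $\kappa$, a module is $\kappa$-generated if it can be generated by at most $\kappa$ elements; a module $N$ is $\kappa$-presented if there is an exact sequence $0\to K\to F\to N\to 0$ with $F$ free of rank $\kappa$ and $K$ a $\kappa$-generated submodule of $F$; a commutative ring $R$ is $\kappa$-coherent if every $\kappa$-generated ideal of $R$ is $\kappa$-presented. A commutative ring $R$ is weakly coherent if every direct product of flat $R$-modules has finite flat dimension. An $R$-module $T$ is strongly finitely presented if it has a projective resolution by finitely generated projective modules; an $R$-module $L$ is level if $\operatorname{Tor}_1^R(L,T)=0$ for every strongly finitely presented $R$-module $T$; a commutative ring $R$ is generalized coherent if the supremum of the flat dimensions of all level $R$-modules is finite. *)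

(* Defs.v *)
From HB Require Import structures.
From mathcomp Require Import all_boot all_order all_algebra generic_quotient.
From mathcomp Require Import boolp classical_sets functions cardinality.

Set Implicit Arguments.
Unset Strict Implicit.
Unset Printing Implicit Defensive.

Import GRing.Theory.
Local Open Scope quotient_scope.
Local Open Scope classical_set_scope.
Local Open Scope card_scope.
Local Open Scope ring_scope.

(** * Generators, bases, cardinals

A cardinal kappa is represented by a type [K] of that cardinality. *)

Section Generation.
Context {S : nzRingType} {V : lmodType S}.
Implicit Types (G : set V) (N : {pred V}).

Definition span G : set V :=
  [set x | exists s : seq V, exists c : V -> S,
     [set` s] `<=` G /\ x = \sum_(v <- s) c v *: v].

Definition lin_indep G : Prop :=
  forall (s : seq V) (c : V -> S), uniq s -> [set` s] `<=` G ->
    \sum_(v <- s) c v *: v = 0 -> {in s, forall v, c v = 0}.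

Definition is_basis G : Prop := lin_indep G /\ span G = setT.

(** [N] is meant to be a submodule of [V]. *)
Definition generated_by_at_most (K : Type) N : Prop :=
  exists G : set V, G #<= [set: K] /\ [set` N] = span G.

Definition finitely_generated N : Prop :=
  exists G : set V, finite_set G /\ [set` N] = span G.

End Generation.

(** Over a field: [V] has dimension |K|; over a commutative ring: [V] is free
of rank |K|. *)
Definition has_basis_of_card (K : Type) (S : nzRingType) (V : lmodType S) :
  Prop := exists B : set V, B #= [set: K] /\ is_basis B.

(** * Exactness, projective modules, kappa-coherence *)

Section Exactness.
Context {R : comNzRingType}.

Definition exact (A B C : zmodType) (f : A -> B) (g : B -> C) : Prop :=
  range f = [set y | g y = 0].

Definition projective (P : lmodType R) : Prop :=
  forall (A B : lmodType R) (g : {linear A -> B}) (f : {linear P -> B}),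
    range g = setT -> exists h : {linear P -> A}, forall x, g (h x) = f x.

(** [N] is a submodule of [V]; the exact sequence 0 -> ker f -> F -> N -> 0 is
given by the map [f : F -> V] with image [N]. *)
Definition presented_by (K : Type) (V : lmodType R) (N : {pred V}) : Prop :=
  exists (F : lmodType R) (f : {linear F -> V}),
    [/\ has_basis_of_card K F,
        range f = [set` N]
      & generated_by_at_most K [pred x : F | f x == 0]].

End Exactness.

Definition kappa_coherent (K : Type) (R : comNzRingType) : Prop :=
  forall I : {pred R^o}, submod_closed I ->
    generated_by_at_most K I -> presented_by K I.

(** * Tensor products

[L (x) M] is the quotient of the monoid of formal sums of pairs by the smallest
congruence making the pairing bilinear and balanced. *)

Section TensorRelation.
Context {R : comNzRingType} (L M : lmodType R).

Inductive tens_rel : seq (L * M) -> seq (L * M) -> Prop :=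
| tens_refl s : tens_rel s s
| tens_sym s t : tens_rel s t -> tens_rel t s
| tens_trans s t u : tens_rel s t -> tens_rel t u -> tens_rel s u
| tens_cat s s' t t' :
    tens_rel s s' -> tens_rel t t' -> tens_rel (s ++ t) (s' ++ t')
| tens_catC s t : tens_rel (s ++ t) (t ++ s)
| tens_0l m : tens_rel [:: (0, m)] [::]
| tens_Dl l l' m : tens_rel [:: (l + l', m)] [:: (l, m); (l', m)]
| tens_Dr l m m' : tens_rel [:: (l, m + m')] [:: (l, m); (l, m')]
| tens_Z a l m : tens_rel [:: (a *: l, m)] [:: (l, a *: m)].

Definition tens_relb : rel (seq (L * M)) := fun s t => `[< tens_rel s t >].

Lemma tens_relb_refl : reflexive tens_relb.
Proof. by move=> s; apply/asboolP/tens_refl. Qed.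

Lemma tens_relb_sym : symmetric tens_relb.
Proof. by move=> s t; apply/asboolP/asboolP; apply: tens_sym. Qed.

Lemma tens_relb_trans : transitive tens_relb.
Proof.
by move=> t s u /asboolP st /asboolP tu; apply/asboolP/(tens_trans st tu).
Qed.

Canonical tens_equiv :=
  EquivRel tens_relb tens_relb_refl tens_relb_sym tens_relb_trans.

Definition tensor : Type := {eq_quot tens_equiv}.

HB.instance Definition _ := Choice.on tensor.
HB.instance Definition _ := EqQuotient.on tensor.

End TensorRelation.

Section TensorModule.
Context {R : comNzRingType} (L M : lmodType R).
Local Notation T := (tensor L M).
Implicit Types (s t : seq (L * M)) (x y : T).

Lemma tensP s t : reflect (tens_rel s t) (s == t %[mod T]).
Proof. by rewrite eqmodE; apply: asboolP. Qed.

Lemma tens_eqP s t : tens_rel s t -> \pi_T s = \pi_T t.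
Proof. by move=> /tensP/eqP. Qed.

Lemma tens_ind (P : T -> Prop) : (forall s, P (\pi_T s)) -> forall x, P x.
Proof. by move=> h x; rewrite -[x]reprK; apply: h. Qed.

Lemma tens_repr s : tens_rel (repr (\pi_T s)) s.
Proof. by apply/tensP; rewrite reprK. Qed.

Definition scale_sum (a : R) s := [seq (a *: p.1, p.2) | p <- s].

Lemma scale_sum_rel a s t :
  tens_rel s t -> tens_rel (scale_sum a s) (scale_sum a t).
Proof.
elim=> {s t} [s|s t _|s t u _ + _|s s' t t' _ + _|s t|m|l l' m|l m m'|b l m] /=.
- exact: tens_refl.
- exact: tens_sym.
- exact: tens_trans.
- by rewrite /scale_sum !map_cat; apply: tens_cat.
- by rewrite /scale_sum !map_cat; apply: tens_catC.
- by rewrite scaler0; apply: tens_0l.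
- by rewrite scalerDr; apply: tens_Dl.
- exact: tens_Dr.
- by rewrite scalerA mulrC -scalerA; apply: tens_Z.
Qed.

Definition tens_zero : T := \pi_T [::].
Definition tens_add x y : T := \pi_T (repr x ++ repr y).
Definition tens_scale a x : T := \pi_T (scale_sum a (repr x)).
Definition tens_opp x : T := tens_scale (-1) x.

Lemma tens_addE s t : tens_add (\pi_T s) (\pi_T t) = \pi_T (s ++ t).
Proof. by apply: tens_eqP; apply: tens_cat; apply: tens_repr. Qed.

Lemma tens_scaleE a s : tens_scale a (\pi_T s) = \pi_T (scale_sum a s).
Proof. exact/tens_eqP/scale_sum_rel/tens_repr. Qed.

Lemma scale_sumDl a b s :
  tens_rel (scale_sum (a + b) s) (scale_sum a s ++ scale_sum b s).
Proof.
elim: s => [|[l m] s IH]; first exact: tens_refl.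
rewrite /= scalerDl -cat1s -[X in tens_rel _ X]cat1s.
apply: tens_trans (tens_cat (tens_Dl _ _ _) IH) _.
rewrite -[X in tens_rel (X ++ _)]cat1s -!catA; apply: tens_cat.
  exact: tens_refl.
rewrite -[X in tens_rel _ (_ ++ X)]cat1s !catA.
by apply: tens_cat (tens_refl _); apply: tens_catC.
Qed.

Lemma scale_sum0 s : tens_rel (scale_sum 0 s) [::].
Proof.
elim: s => [|[l m] s IH]; first exact: tens_refl.
rewrite /= scale0r -cat1s -[X in tens_rel _ X]cat0s.
by apply: tens_cat IH; apply: tens_0l.
Qed.

Lemma tens_addA : associative tens_add.
Proof.
move=> x y z; elim/tens_ind: x => s; elim/tens_ind: y => t; elim/tens_ind: z => u.
by rewrite !tens_addE catA.
Qed.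

Lemma tens_addC : commutative tens_add.
Proof. by move=> x y; apply/tens_eqP/tens_catC. Qed.

Lemma tens_add0 : left_id tens_zero tens_add.
Proof. by move=> x; elim/tens_ind: x => s; rewrite tens_addE. Qed.

Lemma tens_scale1 : left_id 1 tens_scale.
Proof.
move=> x; elim/tens_ind: x => s; rewrite tens_scaleE; congr (\pi_T _).
by rewrite -[RHS]map_id; apply: eq_map => -[l m]; rewrite scale1r.
Qed.

Lemma tens_scaleDl x : {morph tens_scale^~ x : a b / a + b >-> tens_add a b}.
Proof.
elim/tens_ind: x => s a b; rewrite !tens_scaleE tens_addE.
exact/tens_eqP/scale_sumDl.
Qed.

Lemma tens_addN : left_inverse tens_zero tens_opp tens_add.
Proof.
move=> x; rewrite -[X in tens_add _ X]tens_scale1 -tens_scaleDl addNr.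
by elim/tens_ind: x => s; rewrite tens_scaleE; apply/tens_eqP/scale_sum0.
Qed.

HB.instance Definition _ :=
  GRing.isZmodule.Build T tens_addA tens_addC tens_add0 tens_addN.

Lemma tens_scaleA a b x : tens_scale a (tens_scale b x) = tens_scale (a * b) x.
Proof.
elim/tens_ind: x => s; rewrite !tens_scaleE /scale_sum -map_comp.
by congr (\pi_T _); apply: eq_map => -[l m] /=; rewrite scalerA.
Qed.

Lemma tens_scaleDr : right_distributive tens_scale +%R.
Proof.
move=> a x y; elim/tens_ind: x => s; elim/tens_ind: y => t.
by rewrite [X in tens_scale a X]tens_addE !tens_scaleE [RHS]tens_addE
  /scale_sum map_cat.
Qed.

HB.instance Definition _ := GRing.Zmodule_isLmodule.Build R T
  tens_scaleA tens_scale1 tens_scaleDr tens_scaleDl.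

Definition tens (l : L) (m : M) : T := \pi_T [:: (l, m)].

Definition bilinear_map (W : lmodType R) (b : L -> M -> W) : Prop :=
  (forall m, linear (b^~ m)) /\ (forall l, linear (b l)).

Lemma tens_bilinear : bilinear_map tens.
Proof.
have DlE l l' m : tens (l + l') m = tens l m + tens l' m.
  by rewrite [RHS]tens_addE; apply/tens_eqP/tens_Dl.
have DrE l m m' : tens l (m + m') = tens l m + tens l m'.
  by rewrite [RHS]tens_addE; apply/tens_eqP/tens_Dr.
have ZlE a l m : tens (a *: l) m = a *: tens l m by rewrite [RHS]tens_scaleE.
have ZrE a l m : tens l (a *: m) = a *: tens l m.
  by rewrite -ZlE; apply/esym/tens_eqP/tens_Z.
by split=> [m a l l'|l a m m']; rewrite ?DlE ?ZlE ?DrE ?ZrE.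
Qed.

Lemma tens_sum x : x = \sum_(p <- repr x) tens p.1 p.2.
Proof.
rewrite -[LHS]reprK; elim: (repr x) => [|[l m] s IH]; first by rewrite big_nil.
by rewrite big_cons -IH [RHS]tens_addE.
Qed.

(** The linear map on [L (x) M] induced by a bilinear map. *)
Definition tens_lift (W : lmodType R) (b : L -> M -> W) (x : T) : W :=
  \sum_(p <- repr x) b p.1 p.2.

Section Lift.
Variables (W : lmodType R) (b : L -> M -> W) (bP : bilinear_map b).

Lemma tens_lift_rel s t : tens_rel s t ->
  \sum_(p <- s) b p.1 p.2 = \sum_(p <- t) b p.1 p.2.
Proof.
pose bl m := GRing.isLinear.Build _ _ _ _ (b^~ m) (bP.1 m).
pose bL m : {linear L -> W} := HB.pack (b^~ m) (bl m).
pose br l := GRing.isLinear.Build _ _ _ _ (b l) (bP.2 l).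
pose bR l : {linear M -> W} := HB.pack (b l) (br l).
elim=> {s t} [//|s t _ //|s t u _ -> _ -> //|s s' t t' _ + _|s t|m|l l' m|l m m'|a l m].
- by rewrite !big_cat /= => -> ->.
- by rewrite !big_cat /= addrC.
- by rewrite big_seq1 big_nil; exact: (linear0 (bL m)).
- by rewrite !big_cons big_nil !addr0; exact: (linearD (bL m)).
- by rewrite !big_cons big_nil !addr0; exact: (linearD (bR l)).
- rewrite !big_seq1 /=.
  by rewrite (linearZ_LR (bL m) a l : b (a *: l) m = _) (linearZ_LR (bR l) a m : b l _ = _).
Qed.

Lemma tens_lift_pi s : tens_lift b (\pi_T s) = \sum_(p <- s) b p.1 p.2.
Proof. exact/tens_lift_rel/tens_repr. Qed.

Lemma tens_liftE l m : tens_lift b (tens l m) = b l m.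
Proof. by rewrite tens_lift_pi big_seq1. Qed.

Lemma tens_lift_linear : linear (tens_lift b).
Proof.
move=> a x y; elim/tens_ind: x => s; elim/tens_ind: y => t.
rewrite [a *: _]tens_scaleE [X in tens_lift b X]tens_addE !tens_lift_pi.
rewrite big_cat /= big_map scaler_sumr; congr (_ + _).
apply: eq_bigr => -[l m] _ /=.
have := bP.1 m a l 0; rewrite addr0 => ->.
by have := bP.1 m 1 0 0; rewrite !scale1r addr0 -[X in X = _]addr0 => /addrI <-; rewrite addr0.
Qed.

End Lift.

End TensorModule.

(** [L (x) f] *)
Definition tens_map (R : comNzRingType) (L A B : lmodType R)
    (f : {linear A -> B}) : tensor L A -> tensor L B :=
  tens_lift (fun l a => tens l (f a)).

Lemma tens_mapE (R : comNzRingType) (L A B : lmodType R) (f : {linear A -> B})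
  (l : L) (a : A) : tens_map f (tens l a) = tens l (f a).
Proof.
apply: tens_liftE; split=> [m|l'] c x y; first exact: (tens_bilinear L B).1.
by rewrite linearP (tens_bilinear L B).2.
Qed.

(** * Flatness, resolutions, flat dimension, Tor *)

Definition flat (R : comNzRingType) (M : lmodType R) : Prop :=
  forall (A B : lmodType R) (f : {linear A -> B}),
    injective f -> injective (tens_map (L := M) f).

(** ... -> P 1 -> P 0 -> M -> 0 *)
Record resolution (R : comNzRingType) (M : lmodType R) := Resolution {
  res_obj :> nat -> lmodType R;
  res_d : forall n, {linear res_obj n.+1 -> res_obj n};
  res_aug : {linear res_obj 0%N -> M};
  res_aug_surj : range res_aug = setT;
  res_exact0 : exact (res_d 0%N) res_aug;
  res_exactS : forall n, exact (res_d n.+1) (res_d n) }.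

Section Dimension.
Context {R : comNzRingType}.
Implicit Types L M T : lmodType R.

(** There is a resolution 0 -> F n -> ... -> F 0 -> M -> 0 by flat modules. *)
Definition flatdim_le M (n : nat) : Prop :=
  exists F : resolution M,
    (forall i, flat (F i)) /\ (forall i, (n < i)%N -> forall x : F i, x = 0).

Lemma flatdim_le_bool M :
  (exists n, flatdim_le M n) -> exists n, `[< flatdim_le M n >].
Proof. by move=> [n nP]; exists n; apply/asboolP. Qed.

(** [None] stands for infinity; the zero module gets dimension 0. *)
Definition flatdim M : option nat :=
  if pselect (exists n, flatdim_le M n) is left h
  then Some (ex_minn (flatdim_le_bool h)) else None.

Lemma flatdim_infinite M : flatdim M = None <-> forall n, ~ flatdim_le M n.
Proof.
rewrite /flatdim; case: pselect => [h|h]; split=> //.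
  by move=> nh; exfalso; case: h => n /nh.
by move=> _ n nP; apply: h; exists n.
Qed.

Definition strongly_finitely_presented T : Prop :=
  exists P : resolution T,
    forall i, projective (P i) /\ finitely_generated (predT : {pred P i}).

(** Tor_1(L, T) is the homology at [L (x) P 1] of [L (x) P], for a projective
resolution [P] of [T]; it does not depend on [P]. *)
Definition Tor1_eq0 L T : Prop :=
  forall P : resolution T, (forall i, projective (P i)) ->
    exact (tens_map (L := L) (res_d P 1%N)) (tens_map (L := L) (res_d P 0%N)).

Definition level L : Prop :=
  forall T, strongly_finitely_presented T -> Tor1_eq0 L T.

End Dimension.

(** * Direct products *)

Definition dprod (R : comNzRingType) (I : Type) (M : I -> lmodType R) : Type :=
  forall i, M i.

Section DirectProduct.
Context {R : comNzRingType} (I : Type) (M : I -> lmodType R).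
Local Notation P := (dprod M).

HB.instance Definition _ := gen_eqMixin P.
HB.instance Definition _ := gen_choiceMixin P.

Definition dprod_zero : P := fun i => 0.
Definition dprod_opp (f : P) : P := fun i => - f i.
Definition dprod_add (f g : P) : P := fun i => f i + g i.
Definition dprod_scale (a : R) (f : P) : P := fun i => a *: f i.

Lemma dprod_addA : associative dprod_add.
Proof. by move=> f g h; apply: functional_extensionality_dep => i; apply: addrA. Qed.
Lemma dprod_addC : commutative dprod_add.
Proof. by move=> f g; apply: functional_extensionality_dep => i; apply: addrC. Qed.
Lemma dprod_add0 : left_id dprod_zero dprod_add.
Proof. by move=> f; apply: functional_extensionality_dep => i; apply: add0r. Qed.
Lemma dprod_addN : left_inverse dprod_zero dprod_opp dprod_add.
Proof. by move=> f; apply: functional_extensionality_dep => i; apply: addNr. Qed.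

HB.instance Definition _ :=
  GRing.isZmodule.Build P dprod_addA dprod_addC dprod_add0 dprod_addN.

Lemma dprod_scaleA a b (f : P) :
  dprod_scale a (dprod_scale b f) = dprod_scale (a * b) f.
Proof. by apply: functional_extensionality_dep => i; apply: scalerA. Qed.
Lemma dprod_scale1 : left_id 1 dprod_scale.
Proof. by move=> f; apply: functional_extensionality_dep => i; apply: scale1r. Qed.
Lemma dprod_scaleDr : right_distributive dprod_scale +%R.
Proof. by move=> a f g; apply: functional_extensionality_dep => i; apply: scalerDr. Qed.
Lemma dprod_scaleDl f : {morph dprod_scale^~ f : a b / a + b}.
Proof. by move=> a b; apply: functional_extensionality_dep => i; apply: scalerDl. Qed.

HB.instance Definition _ := GRing.Zmodule_isLmodule.Build R P
  dprod_scaleA dprod_scale1 dprod_scaleDr dprod_scaleDl.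

End DirectProduct.

(** R^aleph, for aleph the cardinality of [I] *)
Definition power (R : comNzRingType) (I : Type) : lmodType R :=
  dprod (fun _ : I => R^o : lmodType R).

Definition weakly_coherent (R : comNzRingType) : Prop :=
  forall (I : Type) (M : I -> lmodType R),
    (forall i, flat (M i)) -> flatdim (dprod M) <> None.

Definition generalized_coherent (R : comNzRingType) : Prop :=
  exists n : nat, forall L : lmodType R, level L ->
    exists2 d, flatdim L = Some d & (d <= n)%N.

(** * Local rings and residue fields *)

Section Local.
Context {R : comNzRingType}.
Implicit Types m J : {pred R}.

(** [idealr_closed] is the library's predicate for proper ideals. *)
Definition maximal_ideal m : Prop :=
  idealr_closed m /\
  forall J, idealr_closed J -> {subset m <= J} -> J =i m.

Definition local_ring m : Prop :=
  maximal_ideal m /\ forall J, maximal_ideal J -> J =i m.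

(** [k] is the quotient [R / m], with quotient map [pi]. *)
Definition residue_field m (k : fieldType) (pi : {rmorphism R -> k}) : Prop :=
  range pi = setT /\ forall x, (x \in m) = (pi x == 0).

Definition square_zero m : Prop := {in m &, forall x y, x * y = 0}.

End Local.

(** When m^2 = 0, the ideal [m] as a vector space over the residue field [k]:
the class [pi a] acts as multiplication by [a]. *)
Definition ideal_space (R : comNzRingType) (m : {pred R}) (k : fieldType)
    (pi : {rmorphism R -> k}) (kP : residue_field m pi) (m2 : square_zero m) :
  Type := {x : R | x \in m}.

Section IdealSpace.
Context (R : comNzRingType) (m : {pred R}) (k : fieldType)
  (pi : {rmorphism R -> k}) (kP : residue_field m pi) (m2 : square_zero m).
Local Notation V := (ideal_space kP m2).

HB.instance Definition _ := SubChoice.on V.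

Lemma ideal_space_0 : 0 \in m.
Proof. by rewrite kP.2 rmorph0. Qed.
Lemma ideal_space_N (x : V) : - val x \in m.
Proof. by have := valP x; rewrite !kP.2 rmorphN => /eqP ->; rewrite oppr0. Qed.
Lemma ideal_space_D (x y : V) : val x + val y \in m.
Proof.
by have := (valP x, valP y); rewrite !kP.2 rmorphD => -[/eqP -> /eqP ->];
  rewrite addr0.
Qed.

Definition ideal_space_zero : V := Sub 0 ideal_space_0.
Definition ideal_space_opp (x : V) : V := Sub (- val x) (ideal_space_N x).
Definition ideal_space_add (x y : V) : V :=
  Sub (val x + val y) (ideal_space_D x y).

Lemma ideal_space_addA : associative ideal_space_add.
Proof. by move=> x y z; apply: val_inj; rewrite !SubK addrA. Qed.
Lemma ideal_space_addC : commutative ideal_space_add.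
Proof. by move=> x y; apply: val_inj; rewrite !SubK addrC. Qed.
Lemma ideal_space_add0 : left_id ideal_space_zero ideal_space_add.
Proof. by move=> x; apply: val_inj; rewrite !SubK add0r. Qed.
Lemma ideal_space_addN :
  left_inverse ideal_space_zero ideal_space_opp ideal_space_add.
Proof. by move=> x; apply: val_inj; rewrite !SubK addNr. Qed.

HB.instance Definition _ := GRing.isZmodule.Build V
  ideal_space_addA ideal_space_addC ideal_space_add0 ideal_space_addN.

Lemma val_ideal_spaceD (x y : V) : val (x + y) = val x + val y.
Proof. by rewrite SubK. Qed.

Lemma residue_lift (c : k) : exists a, pi a = c.
Proof. by have [a _ ac] : range pi c; [rewrite kP.1|exists a]. Qed.

Lemma ideal_space_mul (a : R) (x : V) : a * val x \in m.
Proof. by have := valP x; rewrite !kP.2 rmorphM => /eqP ->; rewrite mulr0. Qed.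

Definition ideal_space_scale (c : k) (x : V) : V :=
  Sub (projT1 (cid (residue_lift c)) * val x) (ideal_space_mul _ x).

Lemma val_ideal_space_scale (a : R) (x : V) :
  val (ideal_space_scale (pi a) x) = a * val x.
Proof.
rewrite SubK; case: cid => b /= ba; apply/eqP; rewrite -subr_eq0 -mulrBl m2 //.
  by rewrite kP.2 rmorphB ba subrr.
exact: valP.
Qed.

Lemma ideal_space_scaleA c d x :
  ideal_space_scale c (ideal_space_scale d x) = ideal_space_scale (c * d) x.
Proof.
have [[a <-] [b <-]] := (residue_lift c, residue_lift d).
by apply: val_inj; rewrite -rmorphM !val_ideal_space_scale mulrA.
Qed.

Lemma ideal_space_scale1 : left_id 1 ideal_space_scale.
Proof.
by move=> x; apply: val_inj; rewrite -(rmorph1 pi) val_ideal_space_scale mul1r.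
Qed.

Lemma ideal_space_scaleDr : right_distributive ideal_space_scale +%R.
Proof.
move=> c x y; have [a <-] := residue_lift c.
by apply: val_inj; rewrite val_ideal_spaceD !val_ideal_space_scale val_ideal_spaceD mulrDr.
Qed.

Lemma ideal_space_scaleDl x : {morph ideal_space_scale^~ x : c d / c + d}.
Proof.
move=> c d; have [[a <-] [b <-]] := (residue_lift c, residue_lift d).
by apply: val_inj; rewrite val_ideal_spaceD -rmorphD !val_ideal_space_scale mulrDl.
Qed.

HB.instance Definition _ := GRing.Zmodule_isLmodule.Build k V
  ideal_space_scaleA ideal_space_scale1 ideal_space_scaleDr ideal_space_scaleDl.

End IdealSpace.

(* Main.v *)
Require Import Defs.
From HB Require Import structures.
From mathcomp Require Import all_boot all_order all_algebra.
From mathcomp Require Import boolp classical_sets functions cardinality.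
(* [span] is redefined by [mathcomp.algebra.vector]. *)
Import Defs.

Set Implicit Arguments.
Unset Strict Implicit.
Unset Printing Implicit Defensive.

Import GRing.Theory.
Local Open Scope classical_set_scope.
Local Open Scope card_scope.
Local Open Scope ring_scope.

(** kappa-coherence: every submodule N of a free module F of rank kappa is
kappa-generated. Indeed R e is filtered by m e, a sum of kappa simple modules,
and F is the union of its kappa many submodules spanned by finitely many basis
vectors, since kappa has kappa many finite subsets.

Infinite flat dimension: say that S is acyclic if m (x) S -> S is injective,
i.e. Tor_1(S, k) = 0. If A and the kernel of f : A -> B are acyclic, so is the
image of f: an element z = sum v f(y) = 0 of the image lifts to z' = sum v y in
the kernel, z' is killed by m because m^2 = 0, so acyclicity of the kernel puts
z' in m * ker f, and acyclicity of A applies to the difference of the two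
expressions of z'. Descending along a finite flat resolution, every module of
finite flat dimension is acyclic. But R^I is not: a family f with infinitely
many linearly independent coordinates in m is killed by m, and is not in
m R^I since the coordinates of an element of m R^I span a finite-dimensional
space.

R^I is level over any ring, as R^I (x) Q = Q^I for Q finitely generated
projective, and products of exact sequences are exact. *)

(** * Cardinals *)

(** The map is defined on all of [U], so that injections compose without subtypes; its existence
    thus requires [W] to be inhabited as soon as [U] is. *)
Definition injects {U W : Type} (A : set U) (B : set W) : Prop :=
  exists f : U -> W, (forall x, A x -> B (f x)) /\
    forall x y, A x -> A y -> f x = f y -> x = y.

Lemma choice_on {U W : Type} (w0 : W) (r : U -> W -> Prop) :
  exists f : U -> W, forall x, (exists y, r x y) -> r x (f x).
Proof.
have /choice[f fP] : forall x, exists y, (exists y, r x y) -> r x y.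
  move=> x; case: (pselect (exists y, r x y)) => [[y rxy]|nr]; first by exists y.
  by exists w0 => /nr.
by exists f.
Qed.

Lemma injects_trans {U W X : Type} (B : set W) (A : set U) (C : set X) :
  injects A B -> injects B C -> injects A C.
Proof.
move=> [f [fB finj]] [g [gC ginj]]; exists (g \o f); split=> [x /fB/gC //|].
by move=> x y Ax Ay /ginj fxy; apply: finj => //; apply: fxy; apply: fB.
Qed.

Lemma injectsX {U W U' W' : Type} (A : set U) (B : set W) (A' : set U') (B' : set W') :
  injects A B -> injects A' B' -> injects (A `*` A') (B `*` B').
Proof.
move=> [f [fB finj]] [g [gB ginj]]; exists (fun p => (f p.1, g p.2)).
split=> [[x y] [/= Ax Ay]|[x y] [x' y'] [/= Ax Ay] [/= Ax' Ay'] [fxy gxy]].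
  by split; [apply: fB|apply: gB].
by congr (_, _); [apply: finj|apply: ginj].
Qed.

Lemma card_le_injects {U W : Type} (A : set U) (B : set W) :
  B !=set0 -> A #<= B -> injects A B.
Proof.
move=> [w0 Bw0] /card_leP[f].
have [g gP] := choice_on w0
  (fun x y => exists Ax : A x, y = val (f (exist _ x (mem_set Ax)))).
exists g; split=> [x Ax|x y Ax Ay].
  have [|Ax' ->] := gP x; first by exists (val (f (exist _ x (mem_set Ax)))), Ax.
  exact: set_valP.
have [|Ax' ->] := gP x; first by exists (val (f (exist _ x (mem_set Ax)))), Ax.
have [|Ay' ->] := gP y; first by exists (val (f (exist _ y (mem_set Ay)))), Ay.
by move=> /val_inj/inj; rewrite !inE => /(_ I I) [].
Qed.

Section Cardinals.
Context {T : Type}.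

(** Zorn's lemma for graphs of partial bijections between [A] and [B]: a maximal one is defined on
    all of [A] or hits all of [B], since otherwise a pair of missed points could be added. *)
Lemma injects_total (A B : set T) : injects A B \/ injects B A.
Proof.
have [[t0 _]|/forallNP T0] := pselect (exists t : T, True); last first.
  by left; exists id; split=> [x|x]; case: (T0 x).
pose P (G : set (T * T)) := G `<=` A `*` B /\
  forall p q, G p -> G q -> (p.1 = q.1 <-> p.2 = q.2).
have [F FP Ftot|G [[GAB Ginj] Gmax]] := @Zorn_bigcup _ P.
  split=> [p [X FX Xp]|p q [X FX Xp] [Y FY Yq]]; first exact: (FP _ FX).1 Xp.
  by have [XY|YX] := Ftot _ _ FX FY; [apply: (FP _ FY).2 => //; exact: XY|
    apply: (FP _ FX).2 => //; exact: YX].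
have [Adom|] := pselect (forall x, A x -> exists y, G (x, y)).
  left; have [f fP] := choice_on t0 (fun x y => G (x, y)).
  exists f; split=> [x /Adom/fP/GAB[]//|x y /Adom/fP Gx /Adom/fP Gy fxy].
  exact: (Ginj _ _ Gx Gy).2.
move=> /existsNP[a /not_implyP[Aa /forallNP aG]].
have [Bran|] := pselect (forall y, B y -> exists x, G (x, y)).
  right; have [f fP] := choice_on t0 (fun y x => G (x, y)).
  exists f; split=> [x /Bran/fP/GAB[]//|x y /Bran/fP Gx /Bran/fP Gy fxy].
  exact: (Ginj _ _ Gx Gy).1.
move=> /existsNP[b /not_implyP[Bb /forallNP bG]]; exfalso.
apply: (Gmax (G `|` [set (a, b)])).
  split=> [p Gp|/(_ (a, b))]; first by left.
  by move=> /(_ (or_intror erefl)) /aG.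
split=> [p [/GAB//|->//]|[p1 p2] [q1 q2]].
move=> [Gp|[-> ->]] [Gq|[-> ->]] //=; first exact: Ginj Gp Gq.
  by split=> E; [case: (aG p2)|case: (bG p1)]; rewrite -E.
by split=> E; [case: (aG q2)|case: (bG q1)]; rewrite E.
Qed.

(** Two disjoint copies of [A], with first coordinate [a] and [b], lie inside [A * A]; the second
    one receives the points outside [A]. *)
Lemma injects_setU (A B : set T) (a b : T) : A a -> A b -> a <> b ->
  injects (A `*` A) A -> injects B A -> injects (A `|` B) A.
Proof.
move=> Aa Ab ab AA [f [fA finj]]; apply: injects_trans AA.
exists (fun x => if x \in A then (a, x) else (b, f x)).
split=> [x|x y]; rewrite /setU /=; case: ifPn => [/set_mem Ax|/negP Ax].
- by [].
- by case=> [/mem_set//|Bx]; split=> //; apply: fA.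
- by case: ifPn => [_ _ _ [] //|_ _ _ [/ab]].
- move=> Bx; case: ifPn => [_ _ [/esym/ab//]|/negP Ay By [fxy]].
  case: Bx => [/mem_set//|Bx]; case: By => [/mem_set//|By].
  exact: finj.
Qed.

Lemma injects_image {U W : Type} (A : set U) (B : set W) (f : U -> W) (u0 : U) :
  f @` A = B -> injects B A.
Proof.
move=> <-; have [g gP] := choice_on u0 (fun y x => A x /\ f x = y).
have {}gP y : (f @` A) y -> A (g y) /\ f (g y) = y.
  by move=> [x Ax fxy]; apply: gP; exists x.
exists g; split=> [y /gP[]//|x y /gP[_ fx] /gP[_ fy] gxy].
by rewrite -fx gxy.
Qed.

Lemma injects_countable {U : Type} (A : set U) : countable A -> injects A [set: nat].
Proof. by apply: card_le_injects; exists 0%N. Qed.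

(* Hessenberg: Zorn's lemma applied to the graphs of injections of [A * A]
   into [A]. A maximal [A] is equipotent to [T], as otherwise there is room
   for extending the injection to [A `|` B] for some disjoint [B]. *)
Theorem injects_square : infinite_set [set: T] -> injects [set: T * T] [set: T].
Proof.
move=> Tinf; have [t0 _] := infinite_setN0 Tinf.
(* [A] is read off the diagonal of the graph. A graph may give several values to a pair: any choice
   among them is injective. *)
pose dom (G : set (T * T * T)) : set T := [set x | exists z, G (x, x, z)].
pose P G := [/\ forall x y z, G (x, y, z) -> [/\ dom G x, dom G y & dom G z],
  forall x y, dom G x -> dom G y -> exists z, G (x, y, z) &
  forall p q z, G (p, z) -> G (q, z) -> p = q].
have [F FP Ftot|G [[Gdom Gtot Ginj] Gmax]] := @Zorn_bigcup _ P.
  have mono X : F X -> dom X `<=` dom (\bigcup_(Y in F) Y).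
    by move=> FX x [z Xz]; exists z; exists X.
  split=> [x y z [X FX Xz]|x y [z [X FX Xz]] [z' [Y FY Yz']]|p q z [X FX Xp] [Y FY Yq]].
  - have [Px _ _] := FP _ FX; have [dx dy dz] := Px _ _ _ Xz.
    by split; apply: (mono X).
  - have [XY|YX] := Ftot _ _ FX FY.
      have [_ Py _] := FP _ FY; case: (Py x y) => [||w Yw].
      + by exists z; apply: XY.
      + by exists z'.
      by exists w; exists Y.
    have [_ Py _] := FP _ FX; case: (Py x y) => [||w Yw].
    + by exists z.
    + by exists z'; apply: YX.
    by exists w; exists X.
  - have [XY|YX] := Ftot _ _ FX FY.
      by have [_ _ Py] := FP _ FY; apply: Py Yq; apply: XY.
    by have [_ _ Py] := FP _ FX; apply: Py (YX _ Yq).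
set A := dom G in Gdom Gtot.
have AA : injects (A `*` A) A.
  have [f fP] := choice_on t0 (fun p z => G (p, z)).
  have fG p : (A `*` A) p -> G (p, f p).
    by case: p => x y [/= Ax Ay]; apply: fP; apply: Gtot.
  exists f; split=> [[x y] /fG/Gdom[]//|p q /fG Gp /fG Gq fpq].
  by apply: Ginj Gp _; rewrite fpq.
(* Values taken in a set [B] disjoint from [A] cannot collide with the old ones, so such an
   injection would extend [G] to the union of [A] and [B]. *)
have noext (B : set T) : B !=set0 -> (forall x, A x -> B x -> False) ->
    ~ injects ((A `|` B) `*` (A `|` B)) B.
  move=> [b Bb] disj [f [fB finj]].
  pose new p := [/\ (A `|` B) p.1, (A `|` B) p.2 & ~ (A p.1 /\ A p.2)].
  pose H := G `|` [set q | new q.1 /\ q.2 = f q.1].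
  have domH : dom H = A `|` B.
    apply/seteqP; split=> x.
      by move=> [z [Gz|[[] //]]]; left; exists z.
    move=> [[z Gz]|Bx]; first by exists z; left.
    by exists (f (x, x)); right; split=> //; split; [right..|case=> /disj].
  have fnew p : new p -> B (f p) by move=> [? ? _]; apply: fB.
  apply: (Gmax H).
    split=> [p Gp|/(_ (b, b, f (b, b)))]; first by left.
    have Hb : H (b, b, f (b, b)).
      by right; split=> //; split; [right..|case=> /disj].
    by move=> /(_ Hb)/Gdom[/disj].
  split; rewrite ?domH.
  - move=> x y z [/Gdom[]|[/= xyn ->]]; first by split; left.
    by case: (xyn) => /=; split=> //; right; apply: fnew.
  - move=> x y ABx ABy; have [[/= Ax Ay]|nA] := pselect (A x /\ A y).
      by have [z Gz] := Gtot _ _ Ax Ay; exists z; left.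
    by exists (f (x, y)); right.
  - move=> p q z [Gp|[/= pn zp]] [Gq|[/= qn zq]].
    + exact: Ginj Gp Gq.
    + case: p Gp => ? ? /Gdom[_ _ Az]; case: (disj z) => //.
      by rewrite zq; apply: fnew.
    + case: q Gq => ? ? /Gdom[_ _ Az]; case: (disj z) => //.
      by rewrite zp; apply: fnew.
    + by case: (pn) (qn) => ? ? _ [? ? _]; apply: finj => //; rewrite -zp -zq.
(* A finite [A] leaves room for a countably infinite [B] in its complement, and the square of the
   union is countable. *)
have [Afin|Ainf] := pselect (finite_set A).
  have /infiniteP natA : infinite_set (~` A).
    by rewrite -setTD; apply: infinite_setD.
  have [f [fA finj]] : injects [set: nat] (~` A).
    by apply: card_le_injects => //; apply/infinite_setN0/infiniteP.
  exfalso; apply: (noext (range f)).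
  - by exists (f 0%N); exists 0%N.
  - by move=> x Ax [n _ fn]; apply: (fA n I); rewrite fn.
  apply: (injects_trans (B := [set: nat])); last first.
    by exists f; split=> [n _|x y _ _]; [exists n|apply: finj].
  have ABc : injects (A `|` range f) [set: nat].
    rewrite -bigcup2E; apply: injects_countable; apply: bigcup_countable => //.
    by move=> [|[|n]] _ //=; [apply: finite_set_countable|apply: card_image_le].
  apply: injects_trans (injectsX ABc ABc) _.
  apply: injects_countable; exact: countableP.
have [a Aa] := infinite_setN0 Ainf.
have [b [Ab /nesym ba]] : exists b, A b /\ b <> a.
  apply/not_existsP => bP; apply: Ainf; apply: (@sub_finite_set _ _ [set a]) => //.
  by move=> x Ax; apply/not_notP => xa; apply: (bP x).
(* Either the complement contains a copy of [A], which serves as [B], or it injects into [A], and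
   then so does [T]. *)
have [[f [fA finj]]|CA] := injects_total A (~` A).
  exfalso; apply: (noext (f @` A)).
  - by exists (f a); exists a.
  - by move=> x Ax [y Ay fy]; apply: (fA y Ay); rewrite fy.
  have fAA : injects (A `|` f @` A) A.
    by apply: injects_setU ba _ _ => //; apply: injects_image t0 _.
  apply: injects_trans (injectsX fAA fAA) _.
  apply: injects_trans AA _.
  by exists f; split=> [x Ax|]; [exists x|].
have TA : injects [set: T] A by rewrite -(setUv A); apply: injects_setU ba _ _.
have := injectsX TA TA; rewrite setXTT => TTA.
by apply: injects_trans (injects_trans TTA AA) _; exists id.
Qed.

Lemma injects_surj {U W : Type} : inhabited U -> injects [set: U] [set: W] ->
  exists g : W -> U, forall u, exists w, g w = u.
Proof.
move=> [u0] [f [_ finj]]; have [g gP] := choice_on u0 (fun w u => f u = w).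
by exists g => u; exists (f u); apply: finj => //; apply: gP; exists u.
Qed.

Lemma infinite_square_surj : infinite_set [set: T] ->
  exists g : T -> T * T, forall p, exists t, g t = p.
Proof.
move=> Tinf; apply: injects_surj; last exact: injects_square.
by have [t0 _] := infinite_setN0 Tinf; exact: (inhabits (t0, t0)).
Qed.

(** A code in [T] is split by [pr] into a length, read by [num], and an iterated pair, from which
    [dec] takes that many entries. *)
Lemma infinite_seq_surj : infinite_set [set: T] ->
  exists g : T -> seq T, forall s, exists t, g t = s.
Proof.
move=> Tinf; have [t0 _] := infinite_setN0 Tinf.
have [pr prP] := infinite_square_surj Tinf.
have [num numP] : exists g : T -> nat, forall n, exists t, g t = n.
  apply: injects_surj; first exact: (inhabits 0%N).
  by apply: card_le_injects; [exists t0|apply/infiniteP].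
pose fix dec (n : nat) (t : T) {struct n} : seq T :=
  if n is n'.+1 then (pr t).1 :: dec n' (pr t).2 else [::].
exists (fun t => dec (num (pr t).1) (pr t).2) => s.
have [u us] : exists u, dec (size s) u = s.
  elim: s => [|x s [u us]]; first by exists t0.
  by have [w wE] := prP (x, u); exists w; rewrite /= wE us.
have [v vE] := numP (size s); have [t tE] := prP (v, u).
by exists t; rewrite tE /= vE.
Qed.

End Cardinals.

(** * Linear combinations and bases *)

Section Combinations.
Context {S : nzRingType} {V : lmodType S}.
Implicit Types (G : set V) (s : seq (S * V)).

(** Merges repeated vectors, to pass from lists of weighted vectors, which can be concatenated
    freely, to the sums over distinct vectors that [lin_indep] speaks about. *)
Lemma collect_terms {W : lmodType S} (h : V -> W) s :
  \sum_(p <- s) p.1 *: h p.2 =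
  \sum_(v <- undup (map snd s)) (\sum_(p <- s | p.2 == v) p.1) *: h v.
Proof.
transitivity (\sum_(v <- undup (map snd s)) \sum_(p <- s | p.2 == v) p.1 *: h v).
  rewrite (exchange_big_dep predT) //= big_seq [RHS]big_seq.
  apply: eq_bigr => p ps; rewrite -big_filter.
  rewrite (@eq_filter _ _ (pred1 p.2)); last by move=> v; exact: eq_sym.
  by rewrite filter_pred1_uniq ?undup_uniq ?mem_undup ?map_f ?big_seq1.
by apply: eq_bigr => v _; rewrite scaler_suml.
Qed.

Lemma span_combination G s : (forall p, p \in s -> G p.2) ->
  span G (\sum_(p <- s) p.1 *: p.2).
Proof.
move=> sG; rewrite (collect_terms id).
exists (undup (map snd s)), (fun v => \sum_(p <- s | p.2 == v) p.1); split=> // v /=.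
by rewrite mem_undup => /mapP[p /sG Gp ->].
Qed.

Lemma spanE G x : span G x <->
  exists2 s, (forall p, p \in s -> G p.2) & x = \sum_(p <- s) p.1 *: p.2.
Proof.
split=> [[s [c [sG ->]]]|[s sG ->]]; last exact: span_combination.
exists [seq (c v, v) | v <- s]; first by move=> _ /mapP[v vs ->]; apply: sG.
by rewrite big_map.
Qed.

Lemma lin_indep_combination G s : lin_indep G -> (forall p, p \in s -> G p.2) ->
  \sum_(p <- s) p.1 *: p.2 = 0 ->
  forall v, \sum_(p <- s | p.2 == v) p.1 = 0.
Proof.
move=> Gfree sG; rewrite (collect_terms id) => s0 v.
have [vs|vs] := boolP (v \in map snd s); last first.
  rewrite big_seq_cond big1 // => p /andP[ps /eqP pv]; case/negP: vs.
  by rewrite -pv map_f.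
apply: (Gfree _ (fun v => \sum_(p <- s | p.2 == v) p.1) _ _ s0).
- exact: undup_uniq.
- by move=> w /=; rewrite mem_undup => /mapP[p /sG Gp ->].
- by rewrite mem_undup.
Qed.

Lemma lin_indep_ext G s {W : lmodType S} (h : V -> W) : lin_indep G ->
  (forall p, p \in s -> G p.2) ->
  \sum_(p <- s) p.1 *: p.2 = 0 -> \sum_(p <- s) p.1 *: h p.2 = 0.
Proof.
move=> Gfree sG /(lin_indep_combination Gfree sG) s0.
by rewrite collect_terms big1 // => v _; rewrite s0 scale0r.
Qed.

(** A representation of each vector is chosen; independence gives [f] the same value on every other
    representation, whence linearity. *)
Lemma basis_ext G {W : lmodType S} (h : V -> W) : is_basis G ->
  exists f : {linear V -> W}, forall v, G v -> f v = h v.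
Proof.
move=> [Gfree Gspan].
have /choice[r rP] : forall x, exists s : seq (S * V),
    (forall p, p \in s -> G p.2) /\ x = \sum_(p <- s) p.1 *: p.2.
  by move=> x; have : span G x; [rewrite Gspan|move=> /spanE[s]; exists s].
pose f x := \sum_(p <- r x) p.1 *: h p.2.
have fE x s : (forall p, p \in s -> G p.2) -> x = \sum_(p <- s) p.1 *: p.2 ->
    f x = \sum_(p <- s) p.1 *: h p.2.
  move=> sG xE; pose t := r x ++ [seq (- p.1, p.2) | p <- s].
  have tE (W' : lmodType S) (h' : V -> W') : \sum_(p <- t) p.1 *: h' p.2 =
      \sum_(p <- r x) p.1 *: h' p.2 - \sum_(p <- s) p.1 *: h' p.2.
    rewrite big_cat big_map /= -sumrN; congr (_ + _).
    by apply: eq_bigr => p _; rewrite scaleNr.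
  apply/eqP; rewrite -subr_eq0 -tE; apply/eqP; apply: (lin_indep_ext h Gfree).
    move=> p; rewrite mem_cat => /orP[/(rP x).1 //|/mapP[q /sG Gq ->] //].
  by rewrite (tE _ id) -(rP x).2 -xE subrr.
have flin : linear f.
  move=> a x y; rewrite (fE _ ([seq (a * p.1, p.2) | p <- r x] ++ r y)).
  - rewrite big_cat big_map /= scaler_sumr; congr (_ + _).
    by apply: eq_bigr => p _; rewrite scalerA.
  - move=> p; rewrite mem_cat => /orP[/mapP[q /(rP x).1 Gq ->]|/(rP y).1] //.
  - rewrite big_cat big_map /= -(rP y).2 [in LHS](rP x).2 scaler_sumr.
    by congr (_ + _); apply: eq_bigr => p _; rewrite scalerA.
pose fL := GRing.isLinear.Build _ _ _ _ f flin.
pose F : {linear V -> W} := HB.pack f fL.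
exists F => v Gv; change (f v = h v).
rewrite (fE _ [:: (1, v)]) ?big_seq1 ?scale1r // => p.
by rewrite inE => /eqP ->.
Qed.

End Combinations.

(** * Submodules generated by kappa elements *)

Section Submodules.
Context {R : nzRingType} {V : lmodType R}.
Implicit Types (A B N G : set V) (a : R) (x y : V).

Definition submodule N : Prop :=
  N 0 /\ forall a x y, N x -> N y -> N (a *: x + y).

Lemma submoduleD N x y : submodule N -> N x -> N y -> N (x + y).
Proof. by move=> [_ NP] Nx /(NP 1 _ _ Nx); rewrite scale1r. Qed.

Lemma submoduleZ N a x : submodule N -> N x -> N (a *: x).
Proof. by move=> [N0 NP] Nx; have := NP a _ _ Nx N0; rewrite addr0. Qed.

Lemma submoduleN N x : submodule N -> N x -> N (- x).
Proof. by move=> NP /(submoduleZ (-1) NP); rewrite scaleN1r. Qed.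

Lemma submodule_sum N (I : Type) (s : seq I) (P : pred I) (F : I -> V) :
  submodule N -> (forall i, P i -> N (F i)) -> N (\sum_(i <- s | P i) F i).
Proof.
move=> NP FN; elim/big_ind: _ => //; first exact: NP.1.
by move=> x y; apply: submoduleD.
Qed.

Lemma submodule_span G : submodule (span G).
Proof.
split; first by exists [::], (fun=> 0); rewrite big_nil.
move=> a x y /spanE[s sG ->] /spanE[t tG ->]; apply/spanE.
exists ([seq (a * p.1, p.2) | p <- s] ++ t).
  by move=> p; rewrite mem_cat => /orP[/mapP[q /sG Gq ->]|/tG] //.
rewrite big_cat big_map scaler_sumr; congr (_ + _).
by apply: eq_bigr => p _; rewrite scalerA.
Qed.

Lemma sub_span G : G `<=` span G.
Proof.
move=> x Gx; apply/spanE; exists [:: (1, x)]; last by rewrite big_seq1 scale1r.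
by move=> p; rewrite inE => /eqP ->.
Qed.

Lemma span_sub G N : submodule N -> G `<=` N -> span G `<=` N.
Proof.
move=> NP GN x /spanE[s sG ->]; rewrite big_seq; apply: submodule_sum => // p ps.
by apply: submoduleZ => //; exact/GN/sG.
Qed.

Lemma submoduleI A B : submodule A -> submodule B -> submodule (A `&` B).
Proof.
move=> [A0 AP] [B0 BP]; split=> [//|a x y [Ax Bx] [Ay By]].
by split; [apply: AP|apply: BP].
Qed.

End Submodules.

(** * Kappa-noetherian submodules *)

Section Noetherian.
Context {R : comNzRingType} {V : lmodType R} {K : Type}.
Hypothesis Kinf : infinite_set [set: K].
Implicit Types (A B N G : set V) (a : R) (x y : V).

Definition family_generated (J : Type) N : Prop :=
  exists g : J -> V, N = span (range g).

Lemma family_generated_surj (J J' : Type) (f : J' -> J) N :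
  (forall j, exists i, f i = j) -> family_generated J N -> family_generated J' N.
Proof.
move=> fsurj [g ->]; exists (g \o f); congr (span _).
apply/seteqP; split=> _ [j _ <-]; last by exists (f j).
by have [i <-] := fsurj j; exists i.
Qed.

Definition noetherian A : Prop :=
  forall N, submodule N -> N `<=` A -> family_generated K N.

Definition sum_set A B : set V := [set x | exists2 a, A a & exists2 b, B b & x = a + b].

Lemma submodule_sum_set A B :
  submodule A -> submodule B -> submodule (sum_set A B).
Proof.
move=> [A0 AP] [B0 BP]; split=> [|c _ _ [a Aa [b Bb ->]] [a' Aa' [b' Bb' ->]]].
  by exists 0 => //; exists 0 => //; rewrite addr0.
exists (c *: a + a'); first exact: AP.
by exists (c *: b + b'); [exact: BP|rewrite scalerDr addrACA].
Qed.

(** [A'] maps onto the quotient of [N] by its intersection with [B]: lifts to [N] of generators of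
    [A'], together with generators of that intersection, generate [N]. *)
Lemma noetherian_sum_set A B : submodule A -> submodule B ->
  noetherian A -> noetherian B -> noetherian (sum_set A B).
Proof.
move=> AP BP Anoeth Bnoeth N NP NAB.
pose A' := [set a | A a /\ exists2 b, B b & N (a + b)].
have A'P : submodule A'.
  split=> [|c x y [Ax [b Bb Nxb]] [Ay [b' Bb' Nyb]]].
    by split; [exact: AP.1|exists 0; [exact: BP.1|rewrite addr0; exact: NP.1]].
  split; first exact: AP.2.
  exists (c *: b + b'); first exact: BP.2.
  by rewrite addrACA -scalerDr; apply: NP.2.
have [g1 g1E] : family_generated K A' by apply: Anoeth => // x [].
have [g2 g2E] : family_generated K (N `&` B).
  by apply: Bnoeth => [|x []//]; apply: submoduleI.
have /choice[b bP] : forall k, exists b, B b /\ N (g1 k + b).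
  move=> k; have : A' (g1 k) by rewrite g1E; apply: sub_span; exists k.
  by move=> [_ [b Bb Nb]]; exists b.
have [e eP] := infinite_seq_surj Kinf; have [pr prP] := infinite_square_surj Kinf.
(* [K] surjects onto [bool * K]: whether a coded sequence is empty supplies the boolean. *)
apply: (@family_generated_surj (bool * K) _ (fun k => (nilp (e (pr k).1), (pr k).2))).
  move=> [[] k].
    by have [i iE] := eP [::]; have [j jE] := prP (i, k); exists j; rewrite jE /= iE.
  by have [i iE] := eP [:: k]; have [j jE] := prP (i, k); exists j; rewrite jE /= iE.
pose g (p : bool * K) := if p.1 then g1 p.2 + b p.2 else g2 p.2.
exists g; apply/seteqP; split; last first.
  apply: span_sub => // _ [[[] k] _ <-]; first exact: (bP k).2.
  suff [] : (N `&` B) (g2 k) by [].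
  by rewrite g2E; apply: sub_span; exists k.
have gP := submodule_span (range g).
have NBg : N `&` B `<=` span (range g).
  rewrite g2E; apply: span_sub => // _ [k _ <-]; apply: sub_span.
  by exists (false, k).
have A'g : A' `<=` [set a | exists2 b, B b & (N `&` span (range g)) (a + b)].
  rewrite {1}g1E; apply: span_sub.
    split=> [|c x y [z Bz [Nxz gxz]] [z' Bz' [Nyz gyz]]].
      exists 0; first exact: BP.1.
      by rewrite addr0; split; [exact: NP.1|exact: gP.1].
    exists (c *: z + z'); first exact: BP.2.
    rewrite addrACA -scalerDr.
    by split; [exact: NP.2|exact: gP.2].
  move=> _ [k _ <-]; exists (b k); first exact: (bP k).1.
  by split; [exact: (bP k).2|apply: sub_span; exists (true, k)].
move=> x Nx; have [a Aa [c Bc xE]] := NAB _ Nx.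
have [|b' Bb' [Nab gab]] := A'g a; first by split=> //; exists c; rewrite -?xE.
(* Two completions of [a] to an element of [N] differ by an element of [N] and [B], which is already
   in the span. *)
rewrite -[x](subrK (a + b')); apply: submoduleD => //; apply: NBg; split.
  by apply: submoduleD => //; apply: submoduleN.
by rewrite xE opprD addrACA subrr add0r; apply: submoduleD => //; apply: submoduleN.
Qed.

Definition cyclic x : set V := range (fun a => a *: x).

Lemma submodule_cyclic x : submodule (cyclic x).
Proof.
split=> [|c _ _ [a _ <-] [b _ <-]]; first by exists 0; rewrite ?scale0r.
by exists (c * a + b); rewrite // scalerDl scalerA.
Qed.

(* A family of [K] elements has only [K] finite subfamilies. *)
Lemma noetherian_span (e : K -> V) :
  (forall k, noetherian (cyclic (e k))) -> noetherian (span (range e)).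
Proof.
move=> enoeth N NP Ne.
pose fix A s := if s is k :: s' then sum_set (cyclic (e k)) (A s') else [set 0].
have AP s : submodule (A s) /\ noetherian (A s).
  elim: s => [|k s [Asub Anoeth]] /=.
    split=> [|M [M0 _] MA]; first by split=> // c x y -> ->; rewrite scaler0 addr0.
    exists (fun=> 0); apply/seteqP; split=> [x /MA -> |].
      exact: (submodule_span _).1.
    apply: span_sub => [|_ [_ _ <-] //]; split=> // c x y /MA -> /MA ->.
    by rewrite scaler0 addr0.
  split; first by apply: submodule_sum_set => //; exact: submodule_cyclic.
  by apply: noetherian_sum_set => //; exact: submodule_cyclic.
have eA : span (range e) `<=` [set x | exists s, A s x].
  move=> x /spanE[s se ->] /=.
  elim: s se => [|p s IH] se; first by exists [::]; rewrite big_nil.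
  have [|t tE] := IH; first by move=> q qs; apply: se; rewrite inE qs orbT.
  have [k _ kE] : range e p.2 by apply: se; rewrite inE eqxx.
  exists (k :: t); exists (p.1 *: p.2); first by exists p.1; rewrite // kE.
  by eexists; [exact: tE|rewrite big_cons].
have /choice[g gP] : forall s, exists g : K -> V, N `&` A s = span (range g).
  by move=> s; apply: (AP s).2 => [|x []//]; apply: submoduleI => //; exact: (AP s).1.
have [f fP] := infinite_seq_surj Kinf; have [pr prP] := infinite_square_surj Kinf.
apply: (@family_generated_surj (seq K * K) _ (fun k => (f (pr k).1, (pr k).2))).
  move=> [s k]; have [i iE] := fP s; have [j jE] := prP (i, k).
  by exists j; rewrite jE /= iE.
exists (fun p => g p.1 p.2); apply/seteqP; split=> [x Nx|].
  have [s Ax] := eA _ (Ne _ Nx).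
  have : (N `&` A s) x by [].
  rewrite gP; apply: span_sub; first exact: submodule_span.
  by move=> _ [k _ <-]; apply: sub_span; exists (s, k).
apply: span_sub => // _ [[s k] _ <-] /=.
suff [] : (N `&` A s) (g s k) by [].
by rewrite gP; apply: sub_span; exists k.
Qed.

Section SquareZero.
Variable m : {pred R}.
Hypothesis m_unit : forall a, a \notin m -> exists b, b * a = 1.

Lemma cyclic_sub_unit N a x : submodule N -> a \notin m -> N (a *: x) ->
  cyclic x `<=` N.
Proof.
move=> NP /m_unit[b ba] Nax _ [c _ <-]; rewrite -[x]scale1r -ba -scalerA.
by do 2![apply: submoduleZ => //].
Qed.

(** As everything outside [m] is invertible, the cyclic module is simple or zero, and [N] is all of
    it or zero. *)
Lemma noetherian_cyclic_simple x :
  (forall a, a \in m -> a *: x = 0) -> noetherian (cyclic x).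
Proof.
move=> mx N NP Nx; have [k0 _] := infinite_setN0 Kinf.
have [[a [am Nax]]|Nm] := pselect (exists a, a \notin m /\ N (a *: x)).
  exists (fun=> x); apply/seteqP; split=> [_ /Nx[b _ <-]|].
    by apply: submoduleZ; [exact: submodule_span|apply: sub_span; exists k0].
  apply: span_sub => // _ [_ _ <-]; apply: (cyclic_sub_unit NP am Nax).
  by exists 1; rewrite ?scale1r.
exists (fun=> 0); apply/seteqP; split=> [y Ny|].
  have [a _ yE] := Nx _ Ny.
  rewrite -yE mx; first exact: (submodule_span _).1.
  by apply: contrapT => /negP am; apply: Nm; exists a; rewrite yE.
by apply: span_sub => // _ [_ _ <-]; exact: NP.1.
Qed.

(** Either [N] contains a unit multiple of [x] and is the whole cyclic module, or it lies in [m x],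
    which is generated by the [b k *: x], each of them killed by [m]. *)
Lemma noetherian_cyclic x (b : K -> R) :
  (forall k, forall a, a \in m -> a * b k = 0) ->
  (forall a, a \in m -> span (V := R^o) (range b) a) -> noetherian (cyclic x).
Proof.
move=> mb b_gen N NP Nx; have [k0 _] := infinite_setN0 Kinf.
have [[a [am Nax]]|Nm] := pselect (exists a, a \notin m /\ N (a *: x)).
  exists (fun=> x); apply/seteqP; split=> [_ /Nx[c _ <-]|].
    by apply: submoduleZ; [exact: submodule_span|apply: sub_span; exists k0].
  apply: span_sub => // _ [_ _ <-]; apply: (cyclic_sub_unit NP am Nax).
  by exists 1; rewrite ?scale1r.
have /noetherian_span : forall k, noetherian (cyclic (b k *: x)).
  move=> k; apply: noetherian_cyclic_simple => a am.
  by rewrite scalerA mb // scale0r.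
apply=> // y Ny; have [a _ yE] := Nx _ Ny.
have am : a \in m by apply: contrapT => /negP am; apply: Nm; exists a; rewrite yE.
have [s sb aE] := (spanE _ _).1 (b_gen _ am).
rewrite -yE aE scaler_suml big_seq; apply: submodule_sum => [|p /sb[k _ <-]].
  exact: submodule_span.
by rewrite -scalerA; apply: submoduleZ; [exact: submodule_span|apply: sub_span; exists k].
Qed.

End SquareZero.
End Noetherian.

(** * The free module on [K] as finitely supported functions *)

Section FreeModule.
Context {R : nzRingType} {K : Type}.

Definition finite_support : {pred (K -> R^o)} :=
  fun f => `[< finite_set [set k | f k != 0] >].

Lemma finite_support_submod_closed : submod_closed finite_support.
Proof.
split=> [|a f g /asboolP ff /asboolP gf]; apply/asboolP.
  rewrite (_ : [set k | _] = set0); first exact: finite_set0.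
  by apply/seteqP; split=> // k; rewrite /= eqxx.
apply: (@sub_finite_set _ _ ([set k | f k != 0] `|` [set k | g k != 0])).
  move=> k /=; change (a * f k + g k != 0 -> f k != 0 \/ g k != 0).
  by have [->|fk] := eqVneq (f k) 0; [rewrite mulr0 add0r; right|left].
by rewrite finite_setU.
Qed.

HB.instance Definition _ :=
  GRing.isSubmodClosed.Build R (K -> R^o) finite_support finite_support_submod_closed.

Definition free_module : Type := {f : K -> R^o | f \in finite_support}.

HB.instance Definition _ := SubChoice.on free_module.
HB.instance Definition _ := [SubChoice_isSubLmodule of free_module by <:].

Lemma unit_vector_subproof (k : K) : (fun j => `[< j = k >]%:R) \in finite_support.
Proof.
apply/asboolP; apply: (@sub_finite_set _ _ [set k]) => // j /=.
by case: asboolP => //; rewrite eqxx.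
Qed.

Definition unit_vector (k : K) : free_module :=
  Sub (_ : K -> R^o) (unit_vector_subproof k).

Lemma unit_vectorE k j : val (unit_vector k) j = `[< j = k >]%:R.
Proof. by []. Qed.

Lemma val_combination (I : Type) (s : seq I) (c : I -> R) (f : I -> free_module) j :
  val (\sum_(i <- s) c i *: f i) j = \sum_(i <- s) c i * val (f i) j.
Proof.
elim: s => [|i s IH]; first by rewrite !big_nil.
by rewrite !big_cons -IH.
Qed.

Lemma unit_vector_basis : is_basis (range unit_vector).
Proof.
split=> [s c suniq sG s0 v vs|].
  have [k _ kv] := sG v vs.
  have := congr1 (fun f : free_module => val f k) s0.
  have vk : val v k = 1 by rewrite -kv unit_vectorE asboolT.
  rewrite val_combination (bigD1_seq v) //= vk mulr1 big1_seq ?addr0 // => w /andP[wv ws].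
  have [j _ jw] := sG w ws; rewrite -jw unit_vectorE asboolF ?mulr0 // => kj.
  by move/eqP: wv; apply; rewrite -jw -kv kj.
apply/seteqP; split=> // f _; have /asboolP := valP f.
(* [{classic K}] gives [K] a boolean equality, so that the finite support becomes a list. *)
move=> /(@finite_seqP {classic K})[s sE]; apply/spanE.
exists [seq (val f k : R, unit_vector k) | k : {classic K} <- undup s].
  by move=> p /(@mapP {classic K})[k _ ->]; exists k.
apply: val_inj; apply/funext => j; rewrite big_map val_combination /=.
have [js|js] := boolP (j \in s); last first.
  rewrite big1_seq => [|k /= ks].
    apply: contrapT => /eqP fj; move/negP: js; apply.
    by have : [set k | val f k != 0] j by []; rewrite sE.
  rewrite asboolF ?mulr0 // => jk.
  by move: ks js; rewrite -jk mem_undup => ->.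
rewrite (bigD1_seq (j : {classic K})) ?mem_undup ?undup_uniq //= asboolT // mulr1.
rewrite big1_seq ?addr0 // => k /andP[/eqP kj _].
by rewrite asboolF ?mulr0 // => /esym.
Qed.

End FreeModule.
Arguments free_module : clear implicits.

Lemma unit_vector_inj (R : nzRingType) (K : Type) : injective (@unit_vector R K).
Proof.
move=> i j /(congr1 (fun f => val f i)); rewrite !unit_vectorE asboolT //.
by case: asboolP => // _ /eqP; rewrite oner_eq0.
Qed.

Lemma free_module_basis_card (R : nzRingType) (K : Type) :
  has_basis_of_card K (free_module R K).
Proof.
exists (range unit_vector); split; last exact: unit_vector_basis.
by apply: inj_card_eq => x y _ _; apply: unit_vector_inj.
Qed.

Lemma range_family {T K : Type} (A : set T) : A #<= [set: K] -> A !=set0 ->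
  exists g : K -> T, A = range g.
Proof. by move=> /pfcard_geP[->[]//|/surjfunPex]. Qed.

(** * Kappa-coherence when the maximal ideal squares to zero *)

Section SquareZeroIdeal.
Context {R : comNzRingType} {m : {pred R}} {k : fieldType} (pi : {rmorphism R -> k}).
Hypotheses (kP : residue_field m pi) (m2 : square_zero m).

(** A lift [c] of the inverse class gives [c * a = 1 - n] with [n] in [m], and [1 + n] inverts
    [1 - n] because [n] squares to zero. *)
Lemma unit_mod a : a \notin m -> exists b, b * a = 1.
Proof.
rewrite kP.2 => pa; have [c cE] := residue_lift kP (pi a)^-1.
pose n := 1 - c * a.
have nm : n \in m by rewrite kP.2 rmorphB rmorphM rmorph1 cE mulVf // subrr.
have caE : c * a = 1 - n by rewrite subKr.
by exists ((1 + n) * c); rewrite -mulrA caE mulrDl mul1r mulrBr mulr1 m2 // subr0 subrK.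
Qed.

(** A scalar of [k] acts through any of its lifts to [R], so combinations over [k] are combinations
    over [R]. *)
Lemma ideal_basis_gen (B : set (ideal_space kP m2)) a : is_basis B -> a \in m ->
  span (V := R^o) (val @` B) a.
Proof.
move=> [_ Bgen] am; have : span B (Sub a am) by rewrite Bgen.
have vE : val (Sub a am : ideal_space kP m2) = a by rewrite SubK.
move=> /spanE[s sB aE]; rewrite -vE aE => {aE vE}; elim: s sB => [|[c v] s IH] sB.
  by rewrite big_nil; exact: (submodule_span (V := R^o) _).1.
rewrite big_cons /=; apply: (submoduleD (V := R^o)); first exact: submodule_span.
  have [b <-] := residue_lift kP c.
  rewrite -[X in span _ X]/(val (ideal_space_scale (pi b) v)) val_ideal_space_scale.
  apply: (submoduleZ (V := R^o)); first exact: submodule_span.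
  by apply: sub_span; exists v => //; apply: (sB (c, v)); rewrite inE eqxx.
by apply: IH => p ps; apply: sB; rewrite inE ps orbT.
Qed.

(** Generators of the ideal define a map from the free module of rank kappa; its kernel is generated
    by kappa elements, like every submodule of that free module. *)
Theorem kappa_coherent_square_zero {K : Type} : infinite_set [set: K] ->
  has_basis_of_card K (ideal_space kP m2) -> kappa_coherent K R.
Proof.
move=> Kinf [B [BK Bbasis]] I ICl [G [GK IE]].
have [k0 _] := infinite_setN0 Kinf.
have [b bE] : exists b : K -> R, val @` B = range b.
  apply: range_family.
    apply: card_le_trans (card_image_le _ _) _.
    by move: BK; rewrite card_eq_le => /andP[].
  have [x0 Bx0] : B !=set0.
    apply/set0P/negP => /eqP B0; move: BK; rewrite B0 card_eq_sym card_eq0.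
    by move=> /eqP KE; have : [set: K] k0 by []; rewrite KE.
  by exists (val x0); exists x0.
have Fnoeth : noetherian (K := K) [set: free_module R K].
  rewrite -(unit_vector_basis.2); apply: noetherian_span => // k'.
  apply: (noetherian_cyclic (m := m) _ unit_mod _ (b := b)) => //.
    move=> i a am; have [v _ <-] : (val @` B) (b i) by rewrite bE; exists i.
    by rewrite m2 //; exact: valP.
  by move=> a am; rewrite -bE; exact: ideal_basis_gen.
(* The generators have to be indexed by all of [K]; an empty [G] is replaced by the zero family. *)
have [g gE] : exists g : K -> R^o, span G = span (range g).
  have [G0|/set0P/range_family -/(_ K GK)[g ->]] := eqVneq G set0; last by exists g.
  exists (fun=> 0); rewrite G0; apply/seteqP; split.
    by apply: span_sub => //; exact: submodule_span.
  apply: span_sub => [|_ [_ _ <-]]; first exact: submodule_span.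
  exact: (submodule_span set0).1.
have [h hP] := choice_on k0 (fun v i => unit_vector (R := R) i = v).
have [f fE] := basis_ext (g \o h : free_module R K -> R^o) unit_vector_basis.
have fu i : f (unit_vector i) = g i.
  rewrite fE; last by exists i.
  by congr (g _); apply: unit_vector_inj; apply: hP; exists i.
exists (free_module R K), f; split; first exact: free_module_basis_card.
  rewrite IE gE; apply/seteqP; split=> [_ [x _ <-]|].
    have : span (range unit_vector) x by rewrite unit_vector_basis.2.
    move=> /spanE[s su ->]; rewrite linear_sum big_seq.
    apply: submodule_sum => [|p /su[i _ iE]]; first exact: submodule_span.
    rewrite linearZ_LR -iE fu; apply: submoduleZ; first exact: submodule_span.
    by apply: sub_span; exists i.
  apply: span_sub => [|_ [i _ <-]]; last by exists (unit_vector i).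
  split=> [|a _ _ [x _ <-] [y _ <-]]; first by exists 0; rewrite ?raddf0.
  by exists (a *: x + y); rewrite // linearP.
have [|//|n nE] := Fnoeth [set x | f x = 0].
  split=> [|a x y /= fx fy]; first exact: raddf0.
  by rewrite linearP fx fy scaler0 addr0.
exists (range n); split; first exact: card_image_le.
by rewrite -nE; apply/seteqP; split=> x /= /eqP.
Qed.

End SquareZeroIdeal.

(** * Tensor products and Tor_1(-, k) *)

Section TensorCalculus.
Context {R : comNzRingType}.
Implicit Types L A B C : lmodType R.

Lemma tensDl L A (l l' : L) (a : A) : tens (l + l') a = tens l a + tens l' a.
Proof. by have := (tens_bilinear L A).1 a 1 l l'; rewrite !scale1r. Qed.

Lemma tensDr L A (l : L) (a a' : A) : tens l (a + a') = tens l a + tens l a'.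
Proof. by have := (tens_bilinear L A).2 l 1 a a'; rewrite !scale1r. Qed.

Lemma tens0l L A (a : A) : tens (0 : L) a = 0.
Proof. by have := tensDl (0 : L) 0 a; rewrite addr0 -[LHS]addr0 => /addrI. Qed.

Lemma tens0r L A (l : L) : tens l (0 : A) = 0.
Proof. by have := tensDr l (0 : A) 0; rewrite addr0 -[LHS]addr0 => /addrI. Qed.

Lemma tensZl L A c (l : L) (a : A) : tens (c *: l) a = c *: tens l a.
Proof. by have := (tens_bilinear L A).1 a c l 0; rewrite tens0l !addr0. Qed.

Lemma tensZr L A c (l : L) (a : A) : tens l (c *: a) = c *: tens l a.
Proof. by have := (tens_bilinear L A).2 l c a 0; rewrite tens0r !addr0. Qed.

Lemma tens_suml L A (I : Type) (s : seq I) (F : I -> L) (a : A) :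
  tens (\sum_(i <- s) F i) a = \sum_(i <- s) tens (F i) a.
Proof. by elim: s => [|i s IH]; rewrite ?big_nil ?tens0l // !big_cons tensDl IH. Qed.

Lemma tens_sumr L A (I : Type) (s : seq I) (l : L) (F : I -> A) :
  tens l (\sum_(i <- s) F i) = \sum_(i <- s) tens l (F i).
Proof. by elim: s => [|i s IH]; rewrite ?big_nil ?tens0r // !big_cons tensDr IH. Qed.

(** Turns the vanishing of a tensor into a derivation of [tens_rel], on which one can argue by
    induction. *)
Lemma tens_eq0P L A (s : seq (L * A)) :
  \sum_(p <- s) tens p.1 p.2 = 0 <-> tens_rel s [::].
Proof.
have -> : \sum_(p <- s) tens p.1 p.2 = \pi_(tensor L A)%qT s.
  elim: s => [|[l a] s IH]; first by rewrite big_nil.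
  by rewrite big_cons IH [LHS]tens_addE.
split=> [s0|/tens_eqP -> //]; apply/tensP; apply/eqP; exact: s0.
Qed.

Lemma tens_map_bilinear L A B (f : {linear A -> B}) :
  bilinear_map (fun (l : L) (a : A) => tens l (f a)).
Proof.
by split=> [a|l] c x y; rewrite ?linearP ?tensDl ?tensDr ?tensZl ?tensZr.
Qed.

Lemma tens_map_linear L A B (f : {linear A -> B}) : linear (tens_map (L := L) f).
Proof. exact: tens_lift_linear (tens_map_bilinear L f). Qed.

HB.instance Definition _ L A B (f : {linear A -> B}) :=
  GRing.isLinear.Build R _ _ _ (tens_map (L := L) f) (@tens_map_linear L A B f).

Lemma tens_generated L A (P : tensor L A -> Prop) : P 0 ->
  (forall x y, P x -> P y -> P (x + y)) -> (forall l a, P (tens l a)) -> forall x, P x.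
Proof.
by move=> P0 PD Pt x; rewrite [x]tens_sum; elim/big_ind: _ => // p _; apply: Pt.
Qed.

Lemma tens_map_sum L A B (f : {linear A -> B}) (s : seq (L * A)) :
  tens_map f (\sum_(p <- s) tens p.1 p.2) = \sum_(p <- s) tens p.1 (f p.2).
Proof. by rewrite linear_sum; apply: eq_bigr => p _; exact: tens_mapE. Qed.

End TensorCalculus.

(** A separate name for [V], so that the [R]-module structure through [pi] coexists with the
    structure over [k]. *)
Definition restrict_scalars (R : comNzRingType) (k : fieldType)
  (pi : {rmorphism R -> k}) (V : lmodType k) : Type := V.

Section RestrictionOfScalars.
Context {R : comNzRingType} {k : fieldType} (pi : {rmorphism R -> k}) (V : lmodType k).
Local Notation W := (restrict_scalars pi V).

HB.instance Definition _ := GRing.Zmodule.copy W V.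

Definition restrict_scale (a : R) (v : W) : W := pi a *: (v : V).

Lemma restrict_scaleA a b v :
  restrict_scale a (restrict_scale b v) = restrict_scale (a * b) v.
Proof. by rewrite /restrict_scale scalerA rmorphM. Qed.

Lemma restrict_scale1 : left_id 1 restrict_scale.
Proof. by move=> v; rewrite /restrict_scale rmorph1 scale1r. Qed.

Lemma restrict_scaleDr : right_distributive restrict_scale +%R.
Proof. by move=> a v w; exact: scalerDr. Qed.

Lemma restrict_scaleDl v : {morph restrict_scale^~ v : a b / a + b}.
Proof. by move=> a b; rewrite /restrict_scale rmorphD scalerDl. Qed.

HB.instance Definition _ := GRing.Zmodule_isLmodule.Build R W
  restrict_scaleA restrict_scale1 restrict_scaleDr restrict_scaleDl.

End RestrictionOfScalars.

(** * Vanishing of Tor_1 with the residue field *)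

Section ResidueTor.
Context {R : comNzRingType} {m : {pred R}} {k : fieldType} (pi : {rmorphism R -> k}).
Hypotheses (kP : residue_field m pi) (m2 : square_zero m).
Local Notation V := (ideal_space kP m2).

Lemma val_ideal_space_linear :
  linear (val : restrict_scalars pi V -> R^o).
Proof.
move=> a v w; transitivity (val (ideal_space_scale (pi a) (v : V)) + val (w : V)).
  exact: (val_ideal_spaceD (ideal_space_scale (pi a) (v : V)) (w : V)).
by rewrite val_ideal_space_scale.
Qed.

Definition ideal_product {M : lmodType R} (S : set M) : set M :=
  [set x | exists2 s : seq (V * M), (forall p, p \in s -> S p.2) &
    x = \sum_(p <- s) val p.1 *: p.2].

Lemma submodule_ideal_product (M : lmodType R) (S : set M) :
  submodule S -> submodule (ideal_product S).
Proof.
move=> SP; split; first by exists [::]; rewrite ?big_nil.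
move=> a x y [s sS ->] [t tS ->]; exists ([seq (p.1, a *: p.2) | p <- s] ++ t).
  move=> p; rewrite mem_cat => /orP[/mapP[q /sS Sq ->]|/tS //].
  exact: submoduleZ.
rewrite big_cat big_map scaler_sumr; congr (_ + _).
by apply: eq_bigr => p _; rewrite !scalerA mulrC.
Qed.

Lemma ideal_productZ (M : lmodType R) (S : set M) a x :
  a \in m -> S x -> ideal_product S (a *: x).
Proof.
move=> am Sx; exists [:: (Sub a am : V, x)]; last by rewrite big_seq1 SubK.
by move=> p; rewrite inE => /eqP ->.
Qed.

(* [residue_acyclic S] says that [m (x) S -> S] is injective, i.e. that
   [Tor_1(S, k) = 0]. As [m (x) S] is [m (x)_k (S / m S)], a tensor vanishes iff
   it is killed by [phi (x) 1] for each linear form [phi]; [rho] lifts the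
   values of [phi] to [R]. *)
Definition residue_acyclic {M : lmodType R} (S : set M) : Prop :=
  forall s : seq (V * M), (forall p, p \in s -> S p.2) ->
  \sum_(p <- s) val p.1 *: p.2 = 0 ->
  forall (phi : {linear V -> k^o}) (rho : k -> R), cancel rho pi ->
  ideal_product S (\sum_(p <- s) rho (phi p.1) *: p.2).

(** Flatness makes the tensor of [s] vanish in the product of [F] with [m]. The sum [e] is an
    invariant of tensors modulo [m F]: each generating relation of [tens_rel] changes it by an
    element of [m F]. *)
Lemma flat_residue_acyclic (F : lmodType R) : flat F -> residue_acyclic [set: F].
Proof.
move=> Fflat s _ s0 phi rho rhoK.
pose vl := GRing.isLinear.Build R (restrict_scalars pi V) R^o _ val val_ideal_space_linear.
pose f : {linear restrict_scalars pi V -> R^o} :=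
  HB.pack (val : restrict_scalars pi V -> R^o) vl.
pose t : seq (F * restrict_scalars pi V) := [seq (p.2, p.1) | p <- s].
have t0 : \sum_(p <- t) tens p.1 p.2 = 0.
  have finj : injective f by move=> x y; exact: val_inj.
  apply: (Fflat _ _ f finj); rewrite raddf0 tens_map_sum big_map /=.
  transitivity (tens (0 : F) (1 : R^o)); last exact: tens0l.
  rewrite -s0 tens_suml; apply: eq_bigr => p _.
  by rewrite tensZl -tensZr; congr (tens _ _); rewrite [RHS]mulr1.
move/tens_eq0P in t0.
have FP : submodule (ideal_product [set: F]).
  by apply: submodule_ideal_product; split.
pose e (t : seq (F * restrict_scalars pi V)) := \sum_(p <- t) rho (phi p.2) *: p.1.
suff e_rel u v : tens_rel u v -> ideal_product [set: F] (e u - e v).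
  by have := e_rel _ _ t0; rewrite /e big_map big_nil subr0.
(* [rho] is only a set-theoretic section, so additivity and homogeneity of the coefficients
   [rho (phi v)] hold modulo [m]. *)
have coef a b c l : pi (a - b - c) = 0 -> ideal_product [set: F] (a *: l - (b *: l + c *: l)).
  move=> pabc; rewrite -scalerDl -scalerBl; apply: ideal_productZ => //.
  by rewrite opprD addrA kP.2 pabc.
elim=> {u v t0} [u|u v _|u v w _ + _|u u' v v' _ + _|u v|v|l l' v|l v v'|a l v].
- by rewrite subrr; exact: FP.1.
- by move=> /(submoduleN FP); rewrite opprB.
- by move=> uv vw; rewrite -(subrKA (e v)); apply: submoduleD.
- by move=> uu vv; rewrite /e !big_cat opprD addrACA; apply: submoduleD.
- by rewrite /e !big_cat /= addrC subrr; exact: FP.1.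
- by rewrite /e big_seq1 big_nil scaler0 subr0; exact: FP.1.
- by rewrite /e !big_cons !big_nil !addr0 scalerDr subrr; exact: FP.1.
- rewrite /e !big_cons !big_nil !addr0 /=; apply: coef.
  by rewrite !rmorphB !rhoK linearD -addrA -opprD subrr.
- rewrite /e !big_seq1 /= scalerA.
  have := coef (rho (phi v) * a) (rho (phi (a *: v))) 0 l.
  rewrite scale0r addr0 subr0; apply; rewrite rmorphB rmorphM !rhoK.
  rewrite (linearZ_LR phi (pi a) (v : V) : phi (a *: v) = _).
  by rewrite [X in _ - X]mulrC subrr.
Qed.

Lemma residue_acyclic_range (A B : lmodType R) (f : {linear A -> B})
    (v0 : V) (phi0 : {linear V -> k^o}) (rho : k -> R) :
  cancel rho pi -> phi0 v0 = 1 ->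
  residue_acyclic [set: A] -> residue_acyclic [set x | f x = 0] ->
  residue_acyclic (range f).
Proof.
move=> rhoK phi0v Aac kerac s sf s0 phi rho' rho'K.
have [t [ts tE]] : exists t : seq (V * A), s = [seq (p.1, f p.2) | p <- t] /\
  \sum_(p <- s) val p.1 *: p.2 = f (\sum_(p <- t) val p.1 *: p.2).
  elim: s sf {s0} => [|p s IH] sf; first by exists [::]; rewrite !big_nil raddf0.
  have [|t [-> tE]] := IH; first by move=> q qs; apply: sf; rewrite inE qs orbT.
  have [y _ yE] := sf p (mem_head _ _).
  exists ((p.1, y) :: t); split; first by rewrite /= yE -surjective_pairing.
  by rewrite !big_cons tE linearP yE.
set z := \sum_(p <- t) _ in tE.
have fz : f z = 0 by rewrite -tE.
have mz a : a \in m -> a *: z = 0.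
  move=> am; rewrite scaler_sumr big1 // => p _; rewrite scalerA m2 ?scale0r //.
  exact: valP.
(* Acyclicity of the kernel is applied to the single tensor of [v0] and [z]. Since [phi0 v0 = 1], it
   yields [rho 1 *: z]; [rho 1] is 1 modulo [m], and [m] kills [z]. *)
have [u uker zE] : ideal_product [set x | f x = 0] z.
  have := kerac [:: (v0, z)]; rewrite big_seq1 mz; last exact: valP.
  have zker p : p \in [:: (v0, z)] -> [set x | f x = 0] p.2.
    by rewrite inE => /eqP ->.
  move=> /(_ zker erefl phi0 rho rhoK); rewrite big_seq1 phi0v => kerz.
  have z1 : (1 - rho 1) *: z = 0 by rewrite mz // kP.2 rmorphB rmorph1 rhoK subrr.
  by rewrite -[z]scale1r -[1](subrK (rho 1)) scalerDl z1 add0r.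
(* The difference of the two expressions of [z] is a relation in [A]; the terms coming from [u]
   disappear under [f]. *)
have := Aac (t ++ [seq (- p.1, p.2) | p <- u]).
rewrite big_cat big_map /= -/z {1}zE -big_split big1 /=; last first.
  move=> p _; rewrite -scalerDl (_ : val p.1 + val (- p.1) = 0) ?scale0r //.
  by rewrite -val_ideal_spaceD subrr.
move=> /(_ (fun _ _ => I) erefl phi rho' rho'K)[w _ wE].
exists [seq (p.1, f p.2) | p <- w]; first by move=> _ /mapP[q _ ->]; exists q.2.
have fE (r : seq (V * A)) : f (\sum_(p <- r) rho' (phi p.1) *: p.2) =
    \sum_(p <- r) rho' (phi p.1) *: f p.2.
  by rewrite linear_sum; apply: eq_bigr => p _; rewrite linearZ.
have fE' (r : seq (V * A)) : f (\sum_(p <- r) val p.1 *: p.2) =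
    \sum_(p <- r) val p.1 *: f p.2.
  by rewrite linear_sum; apply: eq_bigr => p _; rewrite linearZ.
rewrite ts !big_map /= -fE' -wE fE big_cat big_map [X in _ = _ + X]big1_seq ?addr0 //.
by move=> p /= /uker fp; rewrite fp scaler0.
Qed.

End ResidueTor.

(** * Infinite flat dimension of the powers of [R] *)

Lemma section_exists (R : comNzRingType) (m : {pred R}) (k : fieldType)
  (pi : {rmorphism R -> k}) : residue_field m pi -> exists rho : k -> R, cancel rho pi.
Proof. by move=> kP; have /choice[rho rhoK] := residue_lift kP; exists rho. Qed.

Lemma injective_notin (T : eqType) (f : nat -> T) (l : seq T) :
  injective f -> exists n, f n \notin l.
Proof.
move=> finj; apply: contrapT => /forallNP fl.
have := @uniq_leq_size _ (map f (iota 0 (size l).+1)) l.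
rewrite map_inj_uniq // iota_uniq size_map size_iota ltnn => fl_size.
apply: notF; apply: fl_size => // x /mapP[n _ ->].
by apply: contrapT => /negP; exact: fl.
Qed.

Lemma infinite_injection (T : Type) (A : set T) : infinite_set A ->
  exists2 f : nat -> T, injective f & forall n, A (f n).
Proof.
move=> Ainf; have [f [fA finj]] : injects [set: nat] A.
  by apply: card_le_injects; [exact: infinite_setN0|apply/infiniteP].
by exists f => [x y|n]; [exact: finj|exact: fA].
Qed.

Lemma span_finite_subset (S : nzRingType) (V : lmodType S) (B : set V) (u : seq V) :
  span B = setT -> exists2 l : seq V, [set` l] `<=` B & forall v, v \in u -> span [set` l] v.
Proof.
move=> Bgen; elim: u => [|v u [l lB lu]]; first by exists [::].
have : span B v by rewrite Bgen.
move=> [s [c [sB vE]]]; exists (s ++ l) => [x /=|x].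
  by rewrite mem_cat => /orP[/sB|/lB].
rewrite inE => /orP[/eqP ->|/lu].
  rewrite vE big_seq; apply: submodule_sum => [|w ws]; first exact: submodule_span.
  apply: submoduleZ; first exact: submodule_span.
  by apply: sub_span; rewrite /= mem_cat ws.
apply: span_sub => [|w wl]; first exact: submodule_span.
by apply: sub_span; rewrite /= mem_cat wl orbT.
Qed.

Lemma dual_vector (S : nzRingType) (V : lmodType S) (B : set V) (v : V) :
  is_basis B -> B v ->
  exists2 phi : {linear V -> S^o}, phi v = 1 & forall w, B w -> w != v -> phi w = 0.
Proof.
move=> Bbasis Bv; have [phi phiE] := basis_ext (fun w => (w == v)%:R : S^o) Bbasis.
exists phi => [|w Bw /negPf wv]; first by rewrite phiE // eqxx.
by rewrite phiE // wv.
Qed.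

Section InfiniteDimension.
Context {R : comNzRingType} {m : {pred R}} {k : fieldType} (pi : {rmorphism R -> k}).
Hypotheses (kP : residue_field m pi) (m2 : square_zero m).
Local Notation V := (ideal_space kP m2).
Variable B : set V.
Hypotheses (Bbasis : is_basis B) (Binf : infinite_set B).

(** Images of the differentials are acyclic by induction down from degree [n]; the augmentation is
    the last step. *)
Lemma flatdim_residue_acyclic (M : lmodType R) n :
  flatdim_le M n -> residue_acyclic kP m2 [set: M].
Proof.
move=> [F [Fflat F0]]; have [rho rhoK] := section_exists kP.
have [v0 Bv0] := infinite_setN0 Binf.
have [phi0 phi0v _] := dual_vector Bbasis Bv0.
have Fac i : residue_acyclic kP m2 [set: F i] by exact: flat_residue_acyclic.
have dac j : residue_acyclic kP m2 (range (res_d F (n - j)%N)).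
  elim: j => [|j IH].
    (* [F n.+1] is zero, hence so is the image of [res_d F n]. *)
    move=> s sd _ phi r _; exists [::]; rewrite // big_nil big1_seq // => p /sd[x _ <-].
    by rewrite (F0 _ _ x) ?subn0 // raddf0 scaler0.
  (* Once [j] reaches [n], the truncated difference stays 0 and the claim is unchanged. *)
  have [nj|jn] := leqP n j.
    by rewrite (_ : n - j.+1 = n - j)%N //; move/eqP: (nj) => ->; apply/eqP/leqW.
  apply: (residue_acyclic_range rhoK phi0v) => //.
  by rewrite -(res_exactS F) -subSn // subSS.
rewrite -(res_aug_surj F); apply: (residue_acyclic_range rhoK phi0v) => //.
by rewrite -(res_exact0 F); have := dac n; rewrite subnn.
Qed.

Lemma power_not_residue_acyclic (I : Type) : infinite_set [set: I] ->
  ~ residue_acyclic kP m2 [set: power R I].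
Proof.
move=> /infinite_injection[iota iota_inj _] ac; have [rho rhoK] := section_exists kP.
have [beta beta_inj Bbeta] := infinite_injection Binf.
have [nu nuP] := choice_on 0%N (fun i n => iota n = i).
have nuK n : nu (iota n) = n by apply: iota_inj; apply: nuP; exists n.
(* Along [iota] the coordinates run through independent vectors; elsewhere [nu] may be arbitrary,
   since every value of [beta] lies in [m]. *)
pose f : power R I := fun i => val (beta (nu i)).
have [phi0 phi0v _] := dual_vector Bbasis (Bbeta 0%N).
(* [beta 0%N] kills [f] because [m] squares to zero, so acyclicity would put [rho 1 *: f] in
   [m R^I]. *)
have [|s _] := ac [:: (beta 0%N, f)] (fun _ _ => Logic.I) _ phi0 rho rhoK.
  rewrite big_seq1; apply: functional_extensionality_dep => i.
  by rewrite [LHS]m2 //; exact: valP.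
rewrite big_seq1 phi0v => fE.
(* The coefficients in [m] involve finitely many basis vectors and miss some [beta n], yet the
   coordinate at [iota n] expresses [beta n] through them. *)
have [l lB lspan] := span_finite_subset (map fst s) Bbasis.2.
have [n nl] := injective_notin l beta_inj.
have [phi phiv phiB] := dual_vector Bbasis (Bbeta n).
have phis p : p \in s -> phi p.1 = 0.
  move=> ps; have [t [c [tl ->]]] := lspan _ (map_f fst ps).
  rewrite linear_sum big1_seq // => w /= wt; rewrite linearZ_LR phiB ?scaler0 //.
    exact/lB/tl.
  by apply: contra nl => /eqP <-; exact: tl.
have betaE : beta n = \sum_(p <- s) ideal_space_scale (pi (p.2 (iota n) : R)) p.1.
  apply: val_inj.
  transitivity (rho 1 * val (beta n)).
    by rewrite -(val_ideal_space_scale (kP := kP) (m2 := m2)) rhoK ideal_space_scale1.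
  transitivity ((rho 1 *: f) (iota n) : R); first by rewrite [RHS]/(_ * val (beta _)) nuK.
  rewrite fE; elim: (s) => [|p u IH]; first by rewrite !big_nil.
  by rewrite !big_cons val_ideal_spaceD -IH val_ideal_space_scale mulrC.
have := phiv; rewrite betaE linear_sum big1_seq => [/eqP|p /= ps].
  by rewrite eq_sym oner_eq0.
by rewrite (linearZ_LR phi (pi _) p.1 : phi _ = _) phis // scaler0.
Qed.

Theorem flatdim_power_infinite (I : Type) :
  infinite_set [set: I] -> flatdim (power R I) = None.
Proof.
move=> Iinf; apply/flatdim_infinite => n /flatdim_residue_acyclic.
exact: power_not_residue_acyclic.
Qed.

End InfiniteDimension.

(** * Powers of R are level *)

(** Every tensor has the form [tens 1 a], and multiplication recovers [f a] from its image. *)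
Lemma flat_regular (R : comNzRingType) : flat (R^o : lmodType R).
Proof.
move=> A B f finj x y.
have bil : bilinear_map (fun (r : R^o) (b : B) => (r : R) *: b).
  split=> [b|r] a u v; first by rewrite scalerDl scalerA.
  by rewrite scalerDr !scalerA mulrC.
have tens1 (z : tensor R^o A) : exists a, z = tens 1 a.
  apply: (tens_generated (P := fun z => exists a, z = tens 1 a)).
  - by exists 0; rewrite tens0r.
  - by move=> _ _ [a ->] [a' ->]; exists (a + a'); rewrite tensDr.
  - by move=> r a; exists (r *: a); rewrite tensZr -tensZl; congr tens; rewrite [RHS]mulr1.
have [[a ->] [a' ->]] := (tens1 x, tens1 y).
rewrite !tens_mapE => /(congr1 (tens_lift (fun (r : R^o) (b : B) => (r : R) *: b))).
by rewrite !(tens_liftE bil) !scale1r => /finj ->.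
Qed.

(** * Projective modules: lifting and dual bases *)

Section Image.
Context {R : nzRingType} {A B : lmodType R} (g : {linear A -> B}).

Definition image_pred : {pred B} := fun x => `[< range g x >].

Lemma image_pred_submod_closed : submod_closed image_pred.
Proof.
split=> [|c _ _ /asboolP[a _ <-] /asboolP[b _ <-]]; apply/asboolP.
  by exists 0; rewrite ?raddf0.
by exists (c *: a + b); rewrite // linearP.
Qed.

HB.instance Definition _ :=
  GRing.isSubmodClosed.Build R B image_pred image_pred_submod_closed.

Definition image_module : Type := {x : B | x \in image_pred}.

HB.instance Definition _ := SubChoice.on image_module.
HB.instance Definition _ := [SubChoice_isSubLmodule of image_module by <:].

Lemma image_factor {P : lmodType R} (f : {linear P -> B}) :
  (forall x, range g (f x)) ->
  exists f' : {linear P -> image_module}, forall x, val (f' x) = f x.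
Proof.
move=> fg; pose f' x : image_module := Sub (f x) (asboolT (fg x)).
have f'lin : linear f' by move=> c x y; apply: val_inj; rewrite !SubK linearP.
pose fL := GRing.isLinear.Build _ _ _ _ f' f'lin.
pose F : {linear P -> image_module} := HB.pack f' fL.
by exists F => x; rewrite SubK.
Qed.

End Image.

(** [projective] lifts along surjections, so [g] is first corestricted to its image. *)
Lemma projective_lift (R : comNzRingType) (P A B : lmodType R)
    (g : {linear A -> B}) (f : {linear P -> B}) : projective P ->
  (forall x, range g (f x)) -> exists h : {linear P -> A}, forall x, g (h x) = f x.
Proof.
move=> Pproj fg; have [f' f'E] := image_factor fg.
have [|g' g'E] := image_factor (g := g) (f := g); first by move=> x; exists x.
have [|h hE] := Pproj _ _ g' f'; last by exists h => x; rewrite -f'E -hE g'E.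
apply/seteqP; split=> // y _; have /asboolP[a _ ay] := valP y.
by exists a => //; apply: val_inj; rewrite g'E.
Qed.

Section DualBasis.
Context {R : comNzRingType}.
Implicit Type Q : lmodType R.

(** Projectivity splits the surjection from a free module of finite rank; the forms are the
    coordinates of the splitting. *)
Lemma projective_dual_basis Q :
  projective Q -> finitely_generated (predT : {pred Q}) ->
  exists (n : nat) (q : 'I_n -> Q) (phi : 'I_n -> {linear Q -> R^o}),
    forall x, x = \sum_(i < n) phi i x *: q i.
Proof.
move=> Qproj [G [/finite_seqP[s GE] QE]].
pose q (i : 'I_(size s)) := tnth (in_tuple s) i.
pose f (u : 'rV[R]_(size s)) := \sum_i u 0 i *: q i.
have flin : linear f.
  move=> a u v; rewrite /f scaler_sumr -big_split; apply: eq_bigr => i _.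
  by rewrite !mxE scalerDl scalerA.
pose fL := GRing.isLinear.Build _ _ _ _ f flin.
pose F : {linear 'rV[R]_(size s) -> Q} := HB.pack f fL.
have [|h hE] := Qproj _ _ F (idfun : {linear Q -> Q}).
  apply/seteqP; split=> // x _; have : span G x by rewrite -QE.
  apply: span_sub => [|y].
    split=> [|a _ _ [u _ <-] [v _ <-]]; first by exists 0; rewrite ?raddf0.
    by exists (a *: u + v); rewrite // linearP.
  rewrite GE => ys; have yi : (index y s < size s)%N by rewrite index_mem.
  exists (delta_mx 0 (Ordinal yi)) => //; change (f (delta_mx 0 (Ordinal yi)) = y).
  rewrite /f (bigD1 (Ordinal yi)) //= mxE !eqxx scale1r big1 ?addr0 => [|i /negPf iy].
    by rewrite /q (tnth_nth y) nth_index.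
  by rewrite mxE iy andbF scale0r.
pose phi i x : R^o := h x 0 i.
have philin i : linear (phi i) by move=> a x y; rewrite /phi linearP !mxE.
pose phiL i := GRing.isLinear.Build _ _ _ _ (phi i) (philin i).
pose Phi i : {linear Q -> R^o} := HB.pack (phi i) (phiL i).
by exists (size s), q, Phi => x; rewrite -[LHS]hE.
Qed.

(** * The canonical map from [R^I (x) Q] to [Q^I] *)

Section Evaluation.
Context (I : Type) (Q : lmodType R).
Local Notation L := (power R I).
Local Notation "Q ^I" := (dprod (fun _ : I => Q)) (at level 2).

Definition tens_eval : tensor L Q -> Q^I :=
  tens_lift (fun (r : L) (q : Q) => (fun i => (r i : R) *: q) : Q^I).

Lemma tens_eval_bilinear :
  bilinear_map (fun (r : L) (q : Q) => (fun i => (r i : R) *: q) : Q^I).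
Proof.
split=> [q|r] a x y; apply: functional_extensionality_dep => i.
  change ((a * (x i : R) + (y i : R)) *: q = a *: ((x i : R) *: q) + (y i : R) *: q).
  by rewrite scalerDl scalerA.
change ((r i : R) *: (a *: x + y) = a *: ((r i : R) *: x) + (r i : R) *: y).
by rewrite scalerDr !scalerA mulrC.
Qed.

Lemma tens_evalE r q i : tens_eval (tens r q) i = (r i : R) *: q.
Proof. by rewrite /tens_eval (tens_liftE tens_eval_bilinear). Qed.

Lemma tens_evalD x y i : tens_eval (x + y) i = tens_eval x i + tens_eval y i.
Proof.
have := tens_lift_linear tens_eval_bilinear 1 x y; rewrite scale1r => /(congr1 (@^~ i)).
by rewrite [in RHS]scale1r.
Qed.

Lemma tens_eval0 i : tens_eval 0 i = 0.
Proof. by apply: (addrI (tens_eval 0 i)); rewrite -tens_evalD !addr0. Qed.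

(** A dual basis provides the inverse: [w] goes to the sum of the tensors of [phi j \o w] with
    [q j]. *)
Lemma tens_eval_bij : projective Q -> finitely_generated (predT : {pred Q}) ->
  bijective tens_eval.
Proof.
move=> Qproj Qfg; have [n [q [phi phiE]]] := projective_dual_basis Qproj Qfg.
exists (fun w => \sum_(j < n) tens ((fun i => phi j (w i)) : L) (q j)).
  apply: (tens_generated (P := fun x => \sum_(j < n) _ = x)).
  - rewrite big1 // => j _; rewrite -[RHS](tens0l L (q j)); congr tens.
    by apply: functional_extensionality_dep => i; rewrite tens_eval0 raddf0.
  - move=> x y xE yE; rewrite -[in RHS]xE -[in RHS]yE -big_split.
    apply: eq_bigr => j _ /=; rewrite -tensDl; congr tens.
    by apply: functional_extensionality_dep => i; rewrite tens_evalD raddfD.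
  - move=> r x; rewrite [in RHS](phiE x) tens_sumr; apply: eq_bigr => j _.
    rewrite tensZr -tensZl; congr tens; apply: functional_extensionality_dep => i.
    by rewrite tens_evalE linearZ [LHS]mulrC.
move=> w; apply: functional_extensionality_dep => i; rewrite [RHS]phiE.
elim: (index_enum _) => [|j s IH]; first by rewrite !big_nil tens_eval0.
by rewrite !big_cons tens_evalD IH tens_evalE.
Qed.

End Evaluation.

Lemma tens_eval_map (I : Type) (Q Q' : lmodType R) (d : {linear Q -> Q'}) x i :
  tens_eval (tens_map (L := power R I) d x) i = d (tens_eval x i).
Proof.
apply: (tens_generated (P := fun x => tens_eval (tens_map d x) i = d (tens_eval x i))).
- by rewrite raddf0 !tens_eval0 raddf0.
- by move=> y z yE zE; rewrite raddfD !tens_evalD yE zE raddfD.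
- by move=> r q; rewrite tens_mapE !tens_evalE linearZ.
Qed.

(** Evaluation turns the tensored maps into coordinatewise ones, for which preimages are chosen
    independently in each coordinate. *)
Lemma tens_power_exact (I : Type) (Q2 Q1 Q0 : lmodType R)
    (d1 : {linear Q2 -> Q1}) (d0 : {linear Q1 -> Q0}) (y : tensor (power R I) Q1) :
  projective Q1 -> finitely_generated (predT : {pred Q1}) ->
  projective Q2 -> finitely_generated (predT : {pred Q2}) ->
  exact d1 d0 -> tens_map d0 y = 0 -> range (tens_map (L := power R I) d1) y.
Proof.
move=> Q1p Q1f Q2p Q2f ex y0.
have [f1 f1K _] := tens_eval_bij I Q1p Q1f; have [f2 _ f2K] := tens_eval_bij I Q2p Q2f.
have /choice[w wE] : forall i, exists w, d1 w = tens_eval y i.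
  move=> i; have [w _ <-] : range d1 (tens_eval y i); last by exists w.
  by rewrite ex /= -tens_eval_map y0 tens_eval0.
exists (f2 w) => //; apply: (can_inj f1K).
by apply: functional_extensionality_dep => i; rewrite tens_eval_map f2K wE.
Qed.

End DualBasis.

(** * Comparison of projective resolutions in low degrees *)

Section Comparison.
Context {R : comNzRingType} {T : lmodType R}.

(** Only degrees 0, 1 and 2 enter the homology at [P 1]. *)
Lemma comparison_maps (P Q : resolution T) : (forall i, projective (P i)) ->
  exists (u0 : {linear P 0%N -> Q 0%N}) (u1 : {linear P 1%N -> Q 1%N})
    (u2 : {linear P 2%N -> Q 2%N}),
  [/\ forall x, res_aug Q (u0 x) = res_aug P x,
      forall x, res_d Q 0%N (u1 x) = u0 (res_d P 0%N x)
    & forall x, res_d Q 1%N (u2 x) = u1 (res_d P 1%N x)].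
Proof.
move=> Pproj.
have [|u0 u0E] := projective_lift (g := res_aug Q) (f := res_aug P) (Pproj 0%N).
  by move=> x; rewrite res_aug_surj.
have [|u1 u1E] := projective_lift (g := res_d Q 0%N)
    (f := (u0 \o res_d P 0%N : {linear _ -> _})) (Pproj 1%N).
  move=> x; rewrite res_exact0 /= u0E.
  by have : range (res_d P 0%N) (res_d P 0%N x) by []; rewrite res_exact0.
have [|u2 u2E] := projective_lift (g := res_d Q 1%N)
    (f := (u1 \o res_d P 1%N : {linear _ -> _})) (Pproj 2%N).
  move=> x; rewrite res_exactS /= u1E.
  have : range (res_d P 1%N) (res_d P 1%N x) by [].
  by rewrite res_exactS /= => ->; rewrite raddf0.
by exists u0, u1, u2.
Qed.

Lemma comparison_homotopy (P : resolution T) (w0 : {linear P 0%N -> P 0%N})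
    (w1 : {linear P 1%N -> P 1%N}) : (forall i, projective (P i)) ->
  (forall x, res_aug P (w0 x) = res_aug P x) ->
  (forall x, res_d P 0%N (w1 x) = w0 (res_d P 0%N x)) ->
  exists (h0 : {linear P 0%N -> P 1%N}) (h1 : {linear P 1%N -> P 2%N}),
    forall x, w1 x = x + h0 (res_d P 0%N x) + res_d P 1%N (h1 x).
Proof.
move=> Pproj w0E w1E.
have [|h0 h0E] := projective_lift (g := res_d P 0%N)
    (f := (w0 \- idfun : {linear _ -> _})) (Pproj 0%N).
  by move=> x; rewrite res_exact0 /= linearB w0E subrr.
have [|h1 h1E] := projective_lift (g := res_d P 1%N)
    (f := (w1 \- idfun \- (h0 \o res_d P 0%N) : {linear _ -> _})) (Pproj 1%N).
  by move=> x; rewrite res_exactS /= !linearB w1E h0E /= subrr.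
by exists h0, h1 => x; rewrite h1E /= -[w1 x - x - _]addrA -opprD [RHS]addrC subrK.
Qed.

End Comparison.

Lemma tens_map_comp (R : comNzRingType) (L A B C : lmodType R) (g : {linear B -> C})
    (f : {linear A -> B}) x : tens_map (L := L) g (tens_map f x) = tens_map (g \o f) x.
Proof.
apply: (tens_generated (P := fun x => tens_map g (tens_map f x) = tens_map (g \o f) x)).
- by rewrite !raddf0.
- by move=> y z yE zE; rewrite !linearD /= yE zE.
- by move=> l a; rewrite !tens_mapE.
Qed.

Lemma eq_tens_map (R : comNzRingType) (L A B : lmodType R) (f g : {linear A -> B}) x :
  f =1 g -> tens_map (L := L) f x = tens_map g x.
Proof.
move=> fg; apply: (tens_generated (P := fun x => tens_map f x = tens_map g x)).
- by rewrite !raddf0.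
- by move=> y z yE zE; rewrite !linearD /= yE zE.
- by move=> l a; rewrite !tens_mapE fg.
Qed.

(** [Tor1_eq0] concerns every projective resolution [P], whereas finite generation is known for one
    resolution [Q]. Exactness for [Q] is carried to [P] by comparison maps whose composite is
    homotopic to the identity. *)
Theorem level_power (R : comNzRingType) (I : Type) : level (power R I).
Proof.
move=> T [Q QP] P Pproj; set L := power R I.
have Qproj i : projective (Q i) by have [] := QP i.
have Qfg i : finitely_generated (predT : {pred Q i}) by have [] := QP i.
have [u0 [u1 [u2 [u0E u1E u2E]]]] := comparison_maps Q Pproj.
have [v0 [v1 [v2 [v0E v1E v2E]]]] := comparison_maps P Qproj.
have [||h0 [h1 hE]] := comparison_homotopy (w0 := (v0 \o u0 : {linear _ -> _}))
  (w1 := (v1 \o u1 : {linear _ -> _})) Pproj.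
- by move=> x /=; rewrite v0E u0E.
- by move=> x /=; rewrite v1E u1E.
apply/seteqP; split=> [_ [x _ <-]|y /= y0].
  rewrite /= tens_map_comp (eq_tens_map (g := \0)).
    apply: (tens_generated (P := fun x => tens_map \0 x = 0)).
    - by rewrite raddf0.
    - by move=> a b a0 b0; rewrite linearD /= a0 b0 addr0.
    - by move=> l a; rewrite tens_mapE tens0r.
  move=> a; have : range (res_d P 1%N) (res_d P 1%N a) by [].
  by rewrite res_exactS.
have [|z _ zE] := tens_power_exact (y := tens_map u1 y) (Qproj 1%N) (Qfg 1%N)
    (Qproj 2%N) (Qfg 2%N) (res_exactS Q 0%N).
  rewrite tens_map_comp (eq_tens_map (g := u0 \o res_d P 0%N)) => [|x]; last exact: u1E.
  by rewrite -tens_map_comp y0 raddf0.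
have yE : tens_map (v1 \o u1 : {linear _ -> _}) y =
    y + tens_map h0 (tens_map (res_d P 0%N) y) + tens_map (res_d P 1%N) (tens_map h1 y).
  apply: (tens_generated (P := fun y => tens_map (v1 \o u1 : {linear _ -> _}) y =
    y + tens_map h0 (tens_map (res_d P 0%N) y) + tens_map (res_d P 1%N) (tens_map h1 y))).
  - by rewrite !raddf0 !addr0.
  - move=> a b aE bE; by rewrite !linearD /= aE bE addrACA [X in X + _ = _]addrACA.
  - by move=> l a; rewrite !tens_mapE hE !tensDr.
(* With tensor signs omitted, the homotopy gives [v1 (u1 y) = y + d (h1 y)] for the cycle [y], while
   [u1 y = d z] gives [v1 (u1 y) = d (v2 z)]. *)
exists (tens_map v2 z - tens_map h1 y) => //.
rewrite linearB /=; apply/eqP; rewrite subr_eq; apply/eqP.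
transitivity (tens_map (v1 \o u1 : {linear _ -> _}) y); last by rewrite yE y0 raddf0 addr0.
rewrite tens_map_comp (eq_tens_map (g := v1 \o res_d Q 1%N)) => [|x]; last exact: v2E.
by rewrite -!tens_map_comp zE.
Qed.

(** The countable power of [R] refutes both finiteness conditions: it is a product of flat modules
    and a level module, and its flat dimension is infinite. *)
Theorem proposition3p6 (R : comNzRingType) (m : {pred R}) (k : fieldType)
    (pi : {rmorphism R -> k}) (K : Type)
    (Rlocal : local_ring m) (kP : residue_field m pi) (m2 : square_zero m)
    (Kinf : infinite_set [set: K])
    (dim_m : has_basis_of_card K (ideal_space kP m2)) :
  [/\ kappa_coherent K R,
      forall I : Type, infinite_set [set: I] -> flatdim (power R I) = None,
      ~ weakly_coherent R
    & ~ generalized_coherent R].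
Proof.
have [B [BK Bbasis]] := dim_m.
have Binf : infinite_set B by rewrite (eq_finite_set BK).
have fd := flatdim_power_infinite Bbasis Binf.
split=> //.
- exact: kappa_coherent_square_zero dim_m.
- move=> /(_ nat (fun=> R^o) (fun=> flat_regular (R := R))); apply.
  by rewrite -[RHS](fd nat infinite_nat).
- by move=> [n /(_ _ (level_power (R := R) nat))[d]]; rewrite fd //; exact: infinite_nat.
Qed.
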